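(* Let $\xi,\xi_1,\xi_2,\ldots$ be i.i.d. nonnegative random variables, $S_n=\xi_1+\dots+\xi_n$, and let $\widehat S_1,\widehat S_2,\ldots$ be independent random variables such that $\widehat S_n$ has the same law as $S_n$ for each $n\in\mathbb N$. Assume $\mathbb P\{\xi>t\}=e^{-t^\alpha\ell(t)}$ for $t>0$, some $\alpha\in(0,1)$ and some $\ell$ slowly varying at $\infty$. Putting $H(t):=-\log\mathbb P\{\xi>t\}$, assume also that $$H(t+o(t))-H(t)=\alpha\,o(t)\,t^{-1}H(t)(1+o(1))+o(1)\quad\text{as }t\to\infty,$$ that is, for every function $\Delta$ with $\Delta(t)=o(t)$ one has $H(t+\Delta(t))-H(t)=\alpha\,\Delta(t)\,t^{-1}H(t)(1+o(1))+o(1)$ as $t\to\infty$. Then $$\lim_{t\to\infty}\frac{-\log\mathbb P\{\min_{n\ge1}\widehat S_n>t\}}{t^{\alpha+1}\ell(t)}=\frac1{\mu(\alpha+1)},$$ where $\mu=\mathbb E\xi<\infty$.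
   Context: By independence $\mathbb P\{\min_{n\ge1}\widehat S_n>t\}=\prod_{n\ge1}\mathbb P\{S_n>t\}$. *)

(* Defs.v *)
From HB Require Import structures.
From mathcomp Require Import all_boot all_order all_algebra.
From mathcomp Require Import all_classical all_reals all_analysis.

Set Implicit Arguments.
Unset Strict Implicit.
Unset Printing Implicit Defensive.

Import Order.TTheory GRing.Theory Num.Theory.
Import numFieldNormedType.Exports.

Local Open Scope classical_set_scope.
Local Open Scope ring_scope.

(* Mutual independence of the subfamily (X i), i in D, of an indexed family of
   real random variables: product rule over every finite subset of D. *)
Definition mutually_independent (d : measure_display) (T : measurableType d)
    (R : realType) (P : probability T R) (I : eqType) (D : set I)
    (X : I -> {RV P >-> R}) : Prop :=
  forall (s : seq I) (B : I -> set R),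
    uniq s -> (forall i, i \in s -> D i) ->
    (forall i, i \in s -> measurable (B i)) ->
    P (\bigcap_(i in [set` s]) (X i @^-1` B i)) =
      (\prod_(i <- s) P (X i @^-1` B i))%E.

(* Stated on plain functions so as to apply to sums of random variables. *)
Definition same_law (d : measure_display) (T : measurableType d)
    (R : realType) (P : probability T R) (X Y : T -> R) : Prop :=
  forall A : set R, measurable A -> P (X @^-1` A) = P (Y @^-1` A).

Definition iid (d : measure_display) (T : measurableType d)
    (R : realType) (P : probability T R) (X : nat -> {RV P >-> R}) : Prop :=
  mutually_independent [set: nat] X /\
  (forall m n, same_law P (X m) (X n)).

(* S_n = X_1 + ... + X_n; the term X_0 is not part of the sum. *)
Definition partial_sum (T : Type) (R : realType) (X : nat -> T -> R)
    (n : nat) : T -> R :=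
  fun x => \sum_(1 <= i < n.+1) X i x.

(* A function slowly varying at +oo only has to be positive and measurable in a
   neighbourhood of +oo. *)
Definition slowly_varying (R : realType) (l : R -> R) : Prop :=
  (exists a : R, measurable_fun `]a, +oo[ l /\ forall t, a < t -> 0 < l t) /\
  (forall c : R, 0 < c -> (l (c * t) / l t) @[t --> +oo] --> (1 : R)).

Definition neg_log_tail (d : measure_display) (T : measurableType d)
    (R : realType) (P : probability T R) (X : T -> R) (t : R) : R :=
  - ln (fine (P [set x | t < X x])).

Definition is_minimum (R : realType) (A : set R) (m : R) : Prop :=
  A m /\ lbound A m.

(* The event {min_{n >= 1} X_n > t}. The minimum of infinitely many reals need
   not exist; the outcomes where it does not are outside the event. *)
Definition min_gt (T : Type) (R : realType) (X : nat -> T -> R) (t : R) :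
    set T :=
  [set x | exists m : R,
     is_minimum [set X n x | n in [set n : nat | (0 < n)%N]] m /\ t < m].

(* Main.v *)
(* The law of min_n hatS_n is governed by the single big jump principle. Write
   mu for the mean, H for -log of the tail of xi, and y = t - n mu. For n < t/mu,
   -log P(S_n > t) is asymptotically H(y): one summand exceeding y while the
   others follow the law of large numbers gives the lower bound for P(S_n > t),
   and truncation at y with Chernoff's inequality at the parameter
   theta H(y) / y, theta < 1, gives the upper bound. For n > t/mu, P(S_n <= t)
   decays geometrically in n, which contributes only a constant. Summing,
   -log P(min > t) is asymptotically sum_{n <= t/mu} H(t - n mu). As H is
   monotone and regularly varying, H(xt)/H(t) -> x^alpha uniformly for x in
   [0, 1], so this is t H(t)/mu times a Riemann sum of the integral of
   (1 - x)^alpha over [0, 1]. *)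

Require Import Defs.
From HB Require Import structures.
From mathcomp Require Import all_boot all_order all_algebra.
From mathcomp Require Import all_classical all_reals all_analysis.
From mathcomp Require Import measurable_realfun ring lra zify.

Import Order.TTheory GRing.Theory Num.Theory.
Import numFieldNormedType.Exports.

Local Open Scope classical_set_scope.
Local Open Scope ring_scope.

Set Implicit Arguments.
Unset Strict Implicit.
Unset Printing Implicit Defensive.

(** Only the exponent matters, up to a factor tending to 1, so every bound may lose a fixed
    proportion: [theta < 1] in Chernoff's bound, the indices between [(1 - e) * t / mu] and
    [t / mu], and [delta] in the mean of the summands that do not jump. The obstacle in the upper
    bound is that [xi] has no exponential moments, so the truncated one must be controlled uniformly
    in the truncation level [y]. This works because [H s / s] is almost nonincreasing: up to [y] the
    exponent stays below [kappa * H s] with [kappa < 1], and [expR (kappa * H xi)] is integrable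
    even against [xi ^ 2], so one constant serves all [y]. In the lower bound, giving away [delta]
    makes the law of large numbers fail with probability at most [q ^ n], so that the product of the
    success probabilities over all [n] stays positive. *)

(** * Expectations of products of independent variables *)

Import HBNNSimple.

(** Independence of [W] and [X] is assumed only on indicators of events of [X]; linearity extends it
    to simple functions of [X], and monotone convergence to [f]. *)
Lemma integral_mul_indep (d : measure_display) (T : measurableType d)
    (R : realType) (P : probability T R) (X : {RV P >-> R}) (W : T -> R)
    (f : R -> R) :
  measurable_fun setT W -> (forall x, 0 <= W x) ->
  measurable_fun setT f -> (forall x, 0 <= f x) ->
  (\int[P]_x (W x)%:E < +oo)%E ->
  (forall B, measurable B -> \int[P]_x (W x * \1_(X @^-1` B) x)%:E
     = \int[P]_x (W x)%:E * P (X @^-1` B))%E ->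
  (\int[P]_x (W x * f (X x))%:E
     = \int[P]_x (W x)%:E * \int[P]_x (f (X x))%:E)%E.
Proof.
move=> mW W0 mf f0 Wfin WX.
have mef : measurable_fun [set: R] (fun x => (f x)%:E) by exact/measurable_EFinP.
pose g := nnsfun_approx measurableT mef.
have mX : measurable_fun setT X by exact: measurable_funP.
have mgX n : measurable_fun setT (g n \o X) by apply: measurableT_comp.
have mB n r : measurable (g n @^-1` [set r]) by [].
have mXB n r : measurable (X @^-1` (g n @^-1` [set r])).
  by rewrite -[X in measurable X]setTI; exact: mX.
have cvgf x : (fun n => (g n (X x))%:E) @ \oo --> (f (X x))%:E.
  by apply: (cvg_nnsfun_approx measurableT mef) => // y _; rewrite lee_fin.
have gnd n m x : (n <= m)%N -> g n (X x) <= g m (X x).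
  by move=> nm; exact/lefP/nd_nnsfun_approx.
have step n : (\int[P]_x (W x * g n (X x))%:E
     = \int[P]_x (W x)%:E * \int[P]_x (g n (X x))%:E)%E.
  transitivity (\sum_(k \in range (g n))
      \int[P]_x (k * (W x * \1_(X @^-1` (g n @^-1` [set k])) x))%:E)%E.
    rewrite -ge0_integral_fsum//; last 2 first.
    - move=> k; apply/measurable_EFinP; apply: measurable_funM => //.
      exact: measurable_funM.
    (* Nonnegativity is asked at every real [k]; a negative one has an empty level set, since
       [g n >= 0]. *)
    - move=> k x _; rewrite lee_fin.
      have [k0|k0] := leP 0 k; first by rewrite !mulr_ge0.
      rewrite preimage_nnfun0// preimage_set0 indic0/=.
      by rewrite !mulr0.
    apply: eq_integral => x _; rewrite fsumEFin//; congr EFin.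
    rewrite fimfunE mulrC mulr_fsuml; apply: eq_fsbigr => k _.
    by rewrite -mulrA; congr (_ * _); rewrite mulrC !indicE.
  transitivity (\sum_(k \in range (g n))
     ((\int[P]_x (W x)%:E) * \int[P]_x (k * \1_(X @^-1` (g n @^-1` [set k])) x)%:E))%E.
    apply: eq_fsbigr => k /set_mem[y _ <-].
    under eq_integral do rewrite EFinM.
    under [X in (_ * X)%E]eq_integral do rewrite EFinM.
    rewrite !ge0_integralZl_EFin//; last 3 first.
    - by apply/measurable_EFinP.
    - by move=> x _; rewrite lee_fin mulr_ge0.
    - by apply/measurable_EFinP; exact: measurable_funM.
    by rewrite WX// integral_indic// setIT muleCA.
  rewrite -ge0_mule_fsumr//; last first.
    move=> k; apply: integral_ge0 => x _; rewrite lee_fin.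
    have [k0|k0] := leP 0 k; first by rewrite mulr_ge0.
    by rewrite preimage_nnfun0// preimage_set0 indic0/= mulr0.
  congr (_ * _)%E; rewrite -ge0_integral_fsum//; last 2 first.
  - by move=> k; apply/measurable_EFinP; apply: measurable_funM.
  - move=> k x _; rewrite lee_fin.
    have [k0|k0] := leP 0 k; first by rewrite mulr_ge0.
    by rewrite preimage_nnfun0// preimage_set0 indic0/= mulr0.
  apply: eq_integral => x _; rewrite fsumEFin//; congr EFin.
  by rewrite fimfunE; apply: eq_fsbigr => k _; rewrite !indicE.
have c1 : (\int[P]_x (W x * g n (X x))%:E @[n --> \oo]
    --> \int[P]_x (W x * f (X x))%:E)%E.
  have -> : (\int[P]_x (W x * f (X x))%:E =
      \int[P]_x limn (fun n => (W x * g n (X x))%:E))%E.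
    apply: eq_integral => x _; apply/esym/cvg_lim => //.
    under eq_fun do rewrite EFinM; rewrite EFinM.
    by apply: cvgeZl; [|exact: cvgf].
  apply: cvg_monotone_convergence => //.
  - move=> n; apply/measurable_EFinP/measurable_funM; first exact: mW.
    exact: mgX.
  - by move=> n x _; rewrite lee_fin mulr_ge0.
  - by move=> x _ n m nm; rewrite lee_fin ler_wpM2l// gnd.
have c2 : (\int[P]_x (g n (X x))%:E @[n --> \oo] --> \int[P]_x (f (X x))%:E)%E.
  have -> : (\int[P]_x (f (X x))%:E = \int[P]_x limn (fun n => (g n (X x))%:E))%E.
    by apply: eq_integral => x _; apply/esym/cvg_lim => //; exact: cvgf.
  apply: cvg_monotone_convergence => //.
  - by move=> n; apply/measurable_EFinP; exact: mgX.
  - by move=> n x _; rewrite lee_fin.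
  - by move=> x _ n m nm; rewrite lee_fin gnd.
have fn : (\int[P]_x (W x)%:E \is a fin_num)%E.
  by rewrite ge0_fin_numE// integral_ge0// => x _; rewrite lee_fin.
have := cvgeZl fn c2; under eq_fun do rewrite -step.
exact: cvg_unique c1.
Qed.

Lemma indic_bigcap_seq (T : Type) (R : realType) (I : choiceType) (s : seq I)
    (A : I -> set T) (x : T) :
  \1_(\bigcap_(i in [set` s]) A i) x = \prod_(i <- s) \1_(A i) x :> R.
Proof.
rewrite bigcap_seq; elim: s => [|i s IH].
  by rewrite !big_nil indicE in_setT.
by rewrite !big_cons -IH indicI.
Qed.

Lemma measurable_prod_comp (d : measure_display) (T : measurableType d)
    (R : realType) (P : probability T R) (X : nat -> {RV P >-> R})
    (f : nat -> R -> R) (s : seq nat) :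
  (forall i, measurable_fun setT (f i)) ->
  measurable_fun setT (fun x => \prod_(i <- s) f i (X i x)).
Proof.
by move=> mf; apply: measurable_prod => i _; apply: measurableT_comp.
Qed.

(* The indicator factors make the induction work: each step turns one of the
   indicators into an arbitrary integrand. *)
Lemma indep_integral_prod_indic (d : measure_display) (T : measurableType d)
    (R : realType) (P : probability T R) (X : nat -> {RV P >-> R})
    (f : nat -> R -> R) (s1 s2 : seq nat) (B : nat -> set R) :
  mutually_independent setT X ->
  (forall i, measurable_fun setT (f i)) -> (forall i y, 0 <= f i y) ->
  (forall i, \int[P]_x (f i (X i x))%:E < +oo)%E ->
  uniq (s1 ++ s2) -> (forall i, measurable (B i)) ->
  (\int[P]_x ((\prod_(i <- s1) f i (X i x))
              * \prod_(i <- s2) \1_(B i) (X i x))%:E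
   = (\prod_(i <- s1) \int[P]_x (f i (X i x))%:E)
     * \prod_(i <- s2) P (X i @^-1` B i))%E.
Proof.
move=> indep mf f0 ffin.
have f0' s x : 0 <= \prod_(i <- s) f i (X i x) by apply: prodr_ge0.
have mX i : measurable_fun setT (X i) by exact: measurable_funP.
elim: s1 s2 B => [|i s1 IH] s2 B us mB.
  rewrite big_nil mul1e -(indep s2 B)//.
  rewrite -[X in _ = P X]setIT -integral_indic//; last first.
    apply: bigcap_measurableType => i _.
    by rewrite -[X in measurable X]setTI; exact: mX.
  by apply: eq_integral => x _; rewrite big_nil mul1r indic_bigcap_seq.
pose W x := (\prod_(i <- s1) f i (X i x)) * \prod_(i <- s2) \1_(B i) (X i x).
have us' : uniq (s1 ++ s2) by move: us => /= /andP[].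
have WE : (\int[P]_x (W x)%:E = (\prod_(i <- s1) \int[P]_x (f i (X i x))%:E)
     * \prod_(i <- s2) P (X i @^-1` B i))%E by exact: IH.
under eq_integral => x _.
  rewrite big_cons -mulrA mulrC.
  over.
rewrite (@integral_mul_indep _ _ _ _ (X i) W (f i))//.
- by rewrite WE big_cons muleC muleA.
- apply: measurable_funM; first exact: measurable_prod_comp.
  by apply: (@measurable_prod_comp _ _ _ _ _ (fun i => \1_(B i))) => j.
- by move=> x; rewrite mulr_ge0// prodr_ge0.
- rewrite WE ltey_eq fin_numM//.
    apply: prode_fin_num => j _; rewrite ge0_fin_numE; first exact: ffin.
    by apply: integral_ge0 => x _; rewrite lee_fin.
  apply: prode_fin_num => j _; apply: fin_num_measure.
  by rewrite -[X in measurable X]setTI; exact: mX.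
- move=> C mC.
  (* The event [C] for [X i] joins the indicators, so the induction hypothesis at [i :: s2] is the
     product rule that [integral_mul_indep] requires. *)
  pose B' j := if j == i then C else B j.
  have is2 : i \notin s2 by move: us; rewrite /= mem_cat negb_or => /andP[/andP[]].
  have eB j : j \in s2 -> B' j = B j.
    by rewrite /B'; case: eqP => // ->; rewrite (negbTE is2).
  have us'' : uniq (s1 ++ i :: s2).
    rewrite -(perm_uniq (_ : perm_eq (i :: s1 ++ s2) _))//.
    by rewrite perm_sym perm_catC /= perm_cons perm_catC.
  have mB' j : measurable (B' j) by rewrite /B'; case: ifP.
  have := IH (i :: s2) B' us'' mB'.
  rewrite !big_cons {2}/B' eqxx.
  rewrite [X in _ = (_ * (_ * X))%E -> _](_ : _ = \prod_(i0 <- s2) P (X i0 @^-1` B i0))%E; last first.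
    by apply: eq_big_seq => j /eB ->.
  rewrite (muleC (P _)) muleA -WE => <-.
  apply: eq_integral => x _; rewrite big_cons {1}/B' eqxx /W.
  rewrite [X in _ = (_ * (_ * X))%:E](_ : _ = \prod_(i0 <- s2) \1_(B i0) (X i0 x)); last first.
    by apply: eq_big_seq => j /eB ->.
  by rewrite (mulrC (\1_C _)) mulrA; congr EFin; congr (_ * _); rewrite !indicE.
Qed.

Lemma indep_integral_prod (d : measure_display) (T : measurableType d)
    (R : realType) (P : probability T R) (X : nat -> {RV P >-> R})
    (f : nat -> R -> R) (s : seq nat) :
  mutually_independent setT X ->
  (forall i, measurable_fun setT (f i)) -> (forall i y, 0 <= f i y) ->
  (forall i, \int[P]_x (f i (X i x))%:E < +oo)%E -> uniq s ->
  (\int[P]_x (\prod_(i <- s) f i (X i x))%:E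
   = \prod_(i <- s) \int[P]_x (f i (X i x))%:E)%E.
Proof.
move=> indep mf f0 ffin us.
have := @indep_integral_prod_indic _ _ _ _ X f s [::] (fun=> setT) indep mf f0 ffin.
rewrite cats0 big_nil mule1 => /(_ us (fun=> measurableT)) <-.
by apply: eq_integral => x _; rewrite big_nil mulr1.
Qed.

Lemma same_law_integral (d : measure_display) (T : measurableType d)
    (R : realType) (P : probability T R) (X Y : {RV P >-> R}) (f : R -> R) :
  same_law P X Y -> measurable_fun setT f -> (forall y, 0 <= f y) ->
  (\int[P]_x (f (X x))%:E = \int[P]_x (f (Y x))%:E)%E.
Proof.
move=> XY mf f0.
have mef : measurable_fun [set: R] (fun x => (f x)%:E) by exact/measurable_EFinP.
have ef0 y : (0 <= (f y)%:E)%E by rewrite lee_fin.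
rewrite -(ge0_integral_distribution X mef ef0).
rewrite -(ge0_integral_distribution Y mef ef0).
by apply: eq_measure_integral => A mA _; exact: XY.
Qed.

(** * Monotone regularly varying functions *)

(** With explicit positive thresholds, finitely many eventual bounds are combined by adding the
    thresholds. *)
Lemma near_pinftyP (R : realType) (Q : R -> Prop) :
  (\forall t \near +oo, Q t) <-> exists2 t0, 0 < t0 & forall t, t0 <= t -> Q t.
Proof.
split=> [[M [_ MQ]]|[t0 _ t0Q]].
  exists (`|M| + 1) => [|t tM]; first by have := normr_ge0 M; lra.
  by apply: MQ; have := ler_norm M; lra.
by near=> t; apply: t0Q; near: t; apply: nbhs_pinfty_ge; exact: num_real.
Unshelve. all: by end_near. Qed.

Lemma gt1_ltr_powR (R : realType) (c a b : R) : 1 < c -> a < b ->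
  c `^ a < c `^ b.
Proof.
move=> c1 ab; have c0 : c != 0 by rewrite gt_eqF//; lra.
by rewrite /powR (negbTE c0) ltr_expR ltr_pM2r// ln_gt0.
Qed.

(** Regular variation with index [alpha], together with the two properties that minus the logarithm
    of a tail always has. *)
Definition growth (R : realType) (H : R -> R) (alpha : R) : Prop :=
  [/\ {homo H : x y / x <= y}, forall x, 0 <= H x &
      forall c, 0 < c -> H (c * t) / H t @[t --> +oo] --> c `^ alpha].

(** Division by zero gives 0, so a zero of [H] makes the quotient at [c = 1] vanish, whereas it
    tends to 1. *)
Lemma growth_gt0 (R : realType) (H : R -> R) (alpha : R) : growth H alpha ->
  exists2 t0, 0 < t0 & forall t, t0 <= t -> 0 < H t.
Proof.
move=> [_ H0 Hlim]; apply/near_pinftyP.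
have := Hlim 1 ltr01; rewrite powR1 => /cvgr_gt /(_ 0 ltr01).
apply: filterS => t; rewrite mul1r => Ht; rewrite lt0r H0 andbT.
by apply: contraTneq Ht => ->; rewrite mul0r ltxx.
Qed.

Lemma growth_scale (R : realType) (H : R -> R) (alpha c lo hi : R) :
  growth H alpha -> 0 < c -> lo < c `^ alpha -> c `^ alpha < hi ->
  exists2 t0, 0 < t0 & forall t, t0 <= t ->
    [/\ 0 < H t, lo * H t <= H (c * t) & H (c * t) <= hi * H t].
Proof.
move=> HH c0 lo_c c_hi; have /near_pinftyP Hpos := growth_gt0 HH.
have [_ _ Hlim] := HH; apply/near_pinftyP.
have n1 := cvgr_gt _ (Hlim c c0) _ lo_c.
have n2 := cvgr_lt _ (Hlim c c0) _ c_hi.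
near=> t; have Ht : 0 < H t by near: t.
split=> //.
  by rewrite -ler_pdivlMr//; apply: ltW; near: t; exact: n1.
by rewrite -ler_pdivrMr//; apply: ltW; near: t; exact: n2.
Unshelve. all: by end_near. Qed.

Lemma bernoulli_expr (R : realType) (c : R) (n : nat) : 1 <= c ->
  1 + n%:R * (c - 1) <= c ^+ n.
Proof.
move=> c1; elim: n => [|n IH]; first by rewrite mul0r addr0 expr0.
rewrite exprS -natr1; apply: le_trans (_ : c * (1 + n%:R * (c - 1)) <= _).
  have : 0 <= n%:R * (c - 1) ^+ 2 by rewrite mulr_ge0// sqr_ge0.
  by rewrite expr2; lra.
by rewrite ler_wpM2l//; lra.
Qed.

(** The common core of the Potter-type bounds below: a bound at one scale [c] is iterated until [y]
    has come down to [[s, c * s]], where monotonicity suffices. *)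
Lemma geometric_descent (R : realType) (phi : R -> R) (c t0 s y : R) :
  1 < c -> 0 < t0 -> (forall t, t0 <= t -> phi (c * t) <= phi t) ->
  t0 <= s -> s <= y ->
  exists s', [/\ s <= s', s' <= c * s & phi y <= phi s'].
Proof.
move=> c1 t00 phic t0s sy; have c0 : 0 < c by lra.
have s0 : 0 < s by lra.
have [k yk] : exists k : nat, y <= c ^+ k * s.
  (* By Bernoulli's inequality [c ^+ k] is at least [k * (c - 1)], which exceeds [y / s] for this
     [k]. *)
  exists (Num.trunc (y / s / (c - 1))).+1.
  rewrite -ler_pdivrMr//; apply: le_trans (bernoulli_expr _ (ltW c1)).
  have := truncnS_gt (y / s / (c - 1)); rewrite ltr_pdivrMr; last by lra.
  by lra.
elim: k y sy yk => [|k IH] y sy yk.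
  exists s; split=> //; first by nra.
  by have -> : y = s by rewrite expr0 in yk; lra.
have [ycs|csy] := leP y (c * s); first by exists y.
have [|//|s' [ss' s'c phis']] := IH (y / c).
- by rewrite ler_pdivlMr//; lra.
- by rewrite ler_pdivrMr// mulrAC -exprSr.
exists s'; split=> //; apply: le_trans phis'.
have {1}-> : y = c * (y / c) by rewrite mulrCA divff ?mulr1// gt_eqF.
by apply: phic; rewrite ler_pdivlMr//; nra.
Qed.

(** As [alpha < 1] gives [c ^ alpha < c], the quotient [H t / t] does not increase from [t] to
    [c * t]; descent to [[s, c * s]] then costs one factor [c]. This replaces concavity of [H] in
    Chernoff's bound, with [c] as close to 1 as desired. *)
Lemma growth_upper (R : realType) (H : R -> R) (alpha c : R) :
  growth H alpha -> alpha < 1 -> 1 < c ->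
  exists2 t0, 0 < t0 & forall s y, t0 <= s -> s <= y -> H y * s <= c * H s * y.
Proof.
move=> HH a1 c1; have c0 : 0 < c by lra.
have hi : c `^ alpha < c.
  by rewrite -[ltRHS]powRr1 ?ltW//; exact: gt1_ltr_powR.
have lo : c `^ alpha - 1 < c `^ alpha by lra.
have [t0 t00 Ht0] := growth_scale HH c0 lo hi.
exists t0 => // s y t0s sy.
have [|s' [ss' s'c]] := geometric_descent (phi := fun t => H t / t) c1 t00 _ t0s sy.
  move=> t tt0; have [_ _ Hc] := Ht0 t tt0.
  by rewrite ler_pdivrMr ?mulr_gt0//; last lra; rewrite mulrCA divfK ?gt_eqF//; lra.
have s0 : 0 < s by lra.
have [Hnd H0 _] := HH; have [_ _ Hcs] := Ht0 s t0s.
have s'0 : 0 < s' by lra.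
have y0 : 0 < y by lra.
rewrite ler_pdivrMr// mulrAC ler_pdivlMr// => le1.
have le2 : H s' <= c * H s by apply: le_trans Hcs; exact: Hnd.
have le3 : H y * s <= H y * s' by rewrite ler_wpM2l.
have le4 : H s' * y <= c * H s * y by rewrite ler_wpM2r// ltW.
by lra.
Qed.

(** For [b < alpha], doubling [t] does not increase [t ^ b / H t], so this quotient is bounded by
    its size on [[t0, 2 * t0]]. *)
Lemma growth_lower (R : realType) (H : R -> R) (alpha b : R) :
  growth H alpha -> 0 < b -> b < alpha ->
  exists a t0 : R, [/\ 0 < a, 0 < t0 & forall y, t0 <= y -> a * y `^ b <= H y].
Proof.
move=> HH b0 ba.
have c1 : 1 < 2 :> R by lra.
have lo := gt1_ltr_powR c1 ba.
have hi : 2 `^ alpha < 2 `^ alpha + 1 by lra.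
have [t0 t00 Ht0] := growth_scale HH (ltr0Sn R 1) lo hi.
have [Hnd H0 _] := HH.
have Hpos t : t0 <= t -> 0 < H t by move=> /Ht0[].
have A0 : 0 < (2 * t0) `^ b / H t0.
  by rewrite divr_gt0 ?powR_gt0 ?Hpos//; lra.
exists ((2 * t0) `^ b / H t0)^-1, t0; split=> //; first by rewrite invr_gt0.
move=> y t0y.
have [|s' [ss' s'c]] :=
    geometric_descent (phi := fun t => t `^ b / H t) c1 t00 _ (lexx t0) t0y.
  move=> t tt0; have [Ht Hc _] := Ht0 t tt0.
  have t_ge0 : 0 <= t by lra.
  rewrite powRM// ler_pdivrMr; last by apply: Hpos; lra.
  rewrite mulrAC ler_pdivlMr// (mulrC (2 `^ b)) -mulrA.
  by rewrite ler_wpM2l ?powR_ge0.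
move=> le1; rewrite mulrC ler_pdivrMr// mulrC -ler_pdivrMr; last exact: Hpos.
apply: le_trans le1 _; apply: ler_pM.
- exact: powR_ge0.
- by rewrite invr_ge0.
- by apply: ge0_ler_powR; rewrite ?nnegrE; lra.
- by rewrite lef_pV2 ?posrE ?Hpos//; exact: Hnd.
Qed.

(** Monotone functions converging pointwise to a continuous limit on a compact interval converge
    uniformly: compare with the neighbouring points of a finite grid. Half of [eps] pays for
    convergence on the grid, half for its mesh. *)
Lemma growth_uniform (R : realType) (H : R -> R) (alpha eps : R) :
  growth H alpha -> 0 < alpha -> 0 < eps ->
  exists2 t0, 0 < t0 & forall t x, t0 <= t -> 0 <= x -> x <= 1 ->
    (x `^ alpha - eps) * H t <= H (x * t) <= (x `^ alpha + eps) * H t.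
Proof.
move=> HH a0 eps0; have [Hnd H0 _] := HH.
pose N := (Num.trunc (2 / eps)).+1.
have N0 : 0 < N%:R :> R by rewrite ltr0n.
have NE : N%:R^-1 < eps / 2.
  rewrite -[ltRHS]invf_div ltf_pV2 ?posrE//; last by rewrite divr_gt0.
  exact: truncnS_gt.
(* The grid is equally spaced in the values [x ^ alpha]. It extends to [N.+1] because [x = 1] also
   needs a right neighbour. *)
pose g (j : nat) : R := (j%:R / N%:R) `^ alpha^-1.
have g0 j : 0 <= g j by exact: powR_ge0.
have ga j : g j `^ alpha = j%:R / N%:R.
  by rewrite -powRrM mulVf ?gt_eqF// powRr1// divr_ge0.
have [t0 t00 grid] : exists2 t0, 0 < t0 & forall t, t0 <= t ->
    forall j, (0 < j <= N.+1)%N ->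
      (j%:R / N%:R - eps / 2) * H t <= H (g j * t) /\
      H (g j * t) <= (j%:R / N%:R + eps / 2) * H t.
  elim: N.+1 => [|n [t0 t00 IH]].
    by exists 1 => // t _ j; rewrite leqn0 => /andP[/[swap]/eqP ->].
  have gn0 : 0 < g n.+1 by rewrite powR_gt0// divr_gt0.
  have lo : g n.+1 `^ alpha - eps / 2 < g n.+1 `^ alpha by lra.
  have hi : g n.+1 `^ alpha < g n.+1 `^ alpha + eps / 2 by lra.
  have [t1 t10 Ht1] := growth_scale HH gn0 lo hi.
  exists (t0 + t1) => [|t tt j]; first by lra.
  move=> /andP[j0]; rewrite leq_eqVlt => /orP[/eqP ->|jn].
    by rewrite -ga; have [|_ ? ?] := Ht1 t; [lra|split].
  by apply: IH; [lra|rewrite j0].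
exists t0 => // t x tt0 x0 x1; have t_gt0 : 0 < t by lra.
pose j := Num.trunc (x `^ alpha * N%:R).
have /andP[jx xj] := truncn_itv (mulr_ge0 (powR_ge0 x alpha) (ltW N0)).
rewrite -/j in jx xj.
have {}jx : j%:R / N%:R <= x `^ alpha by rewrite ler_pdivrMr.
have xj' : x `^ alpha < j.+1%:R / N%:R by rewrite ltr_pdivlMr.
have jN : (j <= N)%N.
  rewrite /j truncn_le_nat; apply: (@le_lt_trans _ _ N%:R); last by rewrite ltr_nat.
  rewrite ler_piMl//.
  have : x `^ alpha <= 1 `^ alpha by apply: ge0_ler_powR; rewrite ?nnegrE// ltW.
  by rewrite powR1.
have gx i : i%:R / N%:R <= x `^ alpha -> g i <= x.
  apply: contraTT; rewrite -!ltNge => xg; rewrite -ga.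
  by apply: gt0_ltr_powR; rewrite ?nnegrE.
have xg i : x `^ alpha < i%:R / N%:R -> x <= g i.
  apply: contraTT; rewrite -ltNge -leNgt => xg; rewrite -ga.
  by apply: ge0_ler_powR; rewrite ?nnegrE// ltW.
have jS : j.+1%:R / N%:R = j%:R / N%:R + N%:R^-1 :> R by rewrite -natr1 mulrDl mul1r.
apply/andP; split; last first.
  have [|_ up] := grid t tt0 j.+1; first by rewrite ltnS.
  apply: le_trans (le_trans up _).
    by apply: Hnd; rewrite ler_wpM2r ?(ltW t_gt0)//; exact: xg.
  by rewrite ler_wpM2r//; lra.
(* At the left end there is no positive grid point below [x], but there [x ^ alpha < eps] makes the
   lower bound nonpositive. *)
have [j0|j0] := posnP j.
  apply: (@le_trans _ _ 0) => //; rewrite mulr_le0_ge0//.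
  by move: xj'; rewrite jS j0 mul0r; lra.
have [|lo _] := grid t tt0 j; first by rewrite j0 leqW.
apply: le_trans (le_trans lo _).
  by rewrite ler_wpM2r//; lra.
by apply: Hnd; rewrite ler_wpM2r ?(ltW t_gt0)//; exact: gx.
Qed.

(** * Riemann sums of a power function *)

Lemma powR_tangent (R : realType) (p x y : R) : 0 < p -> 0 <= x -> 0 <= y ->
  x `^ p * (y - x) <= (y `^ (p + 1) - x `^ (p + 1)) / (p + 1).
Proof.
move=> p0 x0 y0; have q0 : 0 < (p + 1) / p by rewrite divr_gt0//; lra.
have p1 : 0 < p + 1 by lra.
have conj : (p + 1)^-1 + ((p + 1) / p)^-1 = 1.
  by field; rewrite !gt_eqF.
have := conjugate_powR y0 (powR_ge0 x p) p1 q0 conj.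
rewrite -powRrM mulrCA divff ?gt_eqF// mulr1.
have xx : x `^ p * x = x `^ (p + 1).
  rewrite powRD ?powRr1//; apply/implyP => /eqP; lra.
have -> : x `^ (p + 1) / ((p + 1) / p) = x `^ (p + 1) - x `^ (p + 1) / (p + 1).
  by field; rewrite !gt_eqF.
by rewrite mulrBr xx mulrBl; lra.
Qed.

Lemma riemann_sum_upper (R : realType) (p h : R) (M : nat) :
  0 < p -> 0 < h -> M%:R * h <= 1 ->
  h * \sum_(n < M.+1) (1 - n%:R * h) `^ p <= h + (p + 1)^-1.
Proof.
move=> p0 h0; have p1 : 0 < p + 1 by lra.
(* The subtracted term is the integral of [(1 - x) ^ p] from [M * h] to 1; keeping it makes the
   induction telescope. The summand [h] is the term [n = 0]. *)
suff : M%:R * h <= 1 -> h * \sum_(n < M.+1) (1 - n%:R * h) `^ p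
    <= h + (p + 1)^-1 - (1 - M%:R * h) `^ (p + 1) / (p + 1).
  move=> S Mh; apply: le_trans (S Mh) _.
  by rewrite gerBl divr_ge0 ?powR_ge0// ltW.
elim: M => [|M IH] Mh.
  by rewrite big_ord_recr big_ord0 /= mul0r subr0 !powR1 add0r mulr1; lra.
rewrite -natr1 mulrDl mul1r in Mh.
rewrite big_ord_recr /= mulrDr -natr1 mulrDl mul1r.
have := IH ltac:(lra).
have := @powR_tangent _ p (1 - (M%:R * h + h)) (1 - M%:R * h) p0 ltac:(lra) ltac:(lra).
rewrite (_ : 1 - M%:R * h - _ = h); last by ring.
by rewrite mulrBl; lra.
Qed.

(** On the left is the integral of [(1 - x) ^ p] from [h] to [M.+1 * h], which the left-endpoint sum
    dominates because the integrand decreases. *)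
Lemma riemann_sum_lower (R : realType) (p h : R) (M : nat) :
  0 < p -> 0 < h -> M.+1%:R * h <= 1 ->
  ((1 - h) `^ (p + 1) - (1 - M.+1%:R * h) `^ (p + 1)) / (p + 1)
    <= h * \sum_(n < M) (1 - n.+1%:R * h) `^ p.
Proof.
move=> p0 h0; elim: M => [|M IH] Mh.
  by rewrite big_ord0 mulr0 (_ : 1%:R * h = h) ?subrr ?mul0r//; exact: mul1r.
rewrite -natr1 mulrDl mul1r in Mh.
rewrite big_ord_recr /= mulrDr.
rewrite (_ : M.+2%:R * h = M.+1%:R * h + h); last by rewrite -natr1 mulrDl mul1r.
have := IH ltac:(lra).
have := @powR_tangent _ p (1 - M.+1%:R * h) (1 - (M.+1%:R * h + h)) p0 ltac:(lra) ltac:(lra).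
rewrite (_ : 1 - (M.+1%:R * h + h) - _ = - h); last by ring.
by rewrite !mulrBl mulrN; lra.
Qed.

(** * Convergence of series weighted by exponentials of H *)

Lemma nneseries_eventually_le (R : realType) (u v : nat -> R) (B : R) (k0 : nat) :
  (forall k, 0 <= u k) -> (forall k, 0 <= v k) ->
  (forall k, (k0 <= k)%N -> u k <= v k) ->
  (forall n, \sum_(0 <= k < n) v k <= B) ->
  (\sum_(k <oo) (u k)%:E < +oo)%E.
Proof.
move=> u0 v0 uv vB.
apply: (@le_lt_trans _ _ (B + \sum_(0 <= k < k0) u k)%:E); last exact: ltry.
apply: lime_le; first by apply: is_cvg_nneseries => k _ _; rewrite lee_fin.
apply: nearW => n; rewrite sumEFin lee_fin.
have [nk|kn] := leqP n k0.
  rewrite [X in _ <= _ + X](big_cat_nat _ nk)//= addrCA lerDl addr_ge0//.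
    by apply: le_trans (vB 0%N); rewrite big_geq.
  by rewrite sumr_ge0.
rewrite (big_cat_nat _ (ltnW kn))//= addrC lerD2r; apply: le_trans (vB n).
rewrite [leRHS](big_cat_nat _ (ltnW kn))//= -[leLHS]add0r lerD ?sumr_ge0//.
by rewrite big_nat [leRHS]big_nat; apply: ler_sum => k /andP[kk _]; exact: uv.
Qed.

(** The comparison series with terms [1 / (k.+1 * k.+2)] telescopes, so its partial sums are
    explicit. *)
Lemma nneseries_quadratic_decay (R : realType) (u : nat -> R) (M : R) (k0 : nat) :
  (forall k, 0 <= u k) ->
  (forall k, (k0 <= k)%N -> u k * (k.+1%:R * k.+2%:R) <= M) ->
  (\sum_(k <oo) (u k)%:E < +oo)%E.
Proof.
move=> u0 uM.
apply: (@nneseries_eventually_le _ u (fun k => `|M| / (k.+1%:R * k.+2%:R)) `|M| k0).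
- exact: u0.
- by move=> k; rewrite divr_ge0// mulr_ge0.
- move=> k kk; rewrite ler_pdivlMr ?mulr_gt0//.
  exact: le_trans (uM k kk) (ler_norm _).
move=> n; suff -> : \sum_(0 <= k < n) `|M| / (k.+1%:R * k.+2%:R) = `|M| - `|M| / n.+1%:R.
  by rewrite gerBl divr_ge0.
elim: n => [|n IH]; first by rewrite big_geq// divr1 subrr.
rewrite big_nat_recr//= IH -[n.+2%:R]natr1; have : 0 < n.+1%:R :> R by rewrite ltr0n.
by move: (n.+1%:R) => y y0; field; rewrite !gt_eqF//; lra.
Qed.

Lemma growth_exp (R : realType) (H : R -> R) (alpha delta K : R) :
  growth H alpha -> 0 < alpha -> 0 < delta ->
  exists2 t0, 0 < t0 & forall y, t0 <= y -> K * y <= expR (delta * H y).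
Proof.
move=> HH a0 dl0.
have [||a [t1 [a_gt0 t10 Ht1]]] := growth_lower (b := alpha / 2) HH; [lra|lra|].
(* Of the exponential series only the term of order [j.+1] is kept; there [y ^ (alpha / 2)] is
   raised to at least [y ^ 2], and the spare factor [y] absorbs [K], the factorial and
   [delta * a]. *)
pose j := Num.trunc (2 / (alpha / 2)).
have F0 : 0 < (j.+1)`!%:R :> R by rewrite ltr0n fact_gt0.
have D0 : 0 < (delta * a) ^+ j.+1 by rewrite exprn_gt0// mulr_gt0.
have q0 : 0 <= `|K| * ((j.+1)`!%:R / (delta * a) ^+ j.+1).
  by rewrite mulr_ge0// divr_ge0// ltW.
exists (1 + t1 + `|K| * ((j.+1)`!%:R / (delta * a) ^+ j.+1)) => [|y yy].
  by lra.
have y1 : 1 <= y by lra.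
have y0 : 0 <= y by lra.
have u0 : 0 <= delta * a * y `^ (alpha / 2) by rewrite !mulr_ge0 ?powR_ge0// ltW.
apply: (@le_trans _ _ (expR (delta * a * y `^ (alpha / 2)))); last first.
  by rewrite ler_expR -mulrA ler_wpM2l ?(ltW dl0)//; apply: Ht1; lra.
have yj : y ^+ 2 <= (y `^ (alpha / 2)) ^+ j.+1.
  rewrite -!powR_mulrn ?powR_ge0// -powRrM ler_powR//.
  have := truncnS_gt (2 / (alpha / 2)); rewrite ltr_pdivrMr; last by lra.
  by rewrite -/j; lra.
have := expR_ge1Dxn j u0; rewrite exprMn => le1.
have {le1} : (delta * a) ^+ j.+1 * (y `^ (alpha / 2)) ^+ j.+1
    <= expR (delta * a * y `^ (alpha / 2)) * (j.+1)`!%:R.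
  by rewrite -ler_pdivrMr//; apply: le_trans le1; rewrite lerDr.
move=> le1; rewrite -(ler_pM2r F0); apply: le_trans le1.
apply: (@le_trans _ _ ((delta * a) ^+ j.+1 * y ^+ 2)); last by rewrite ler_wpM2l// ltW.
have {}yy : `|K| * ((j.+1)`!%:R / (delta * a) ^+ j.+1) <= y by lra.
move: yy; rewrite mulrA ler_pdivrMr// => yy.
rewrite mulrAC expr2 [leRHS]mulrA [(_ ^+ j.+1 * y)%R]mulrC ler_wpM2r//.
by apply: le_trans yy; rewrite ler_wpM2r ?(ltW F0)// ler_norm.
Qed.

(** For [b] between [alpha] and 1, [H t / t ^ b] does not increase under doubling, so
    [H y <= A * y ^ b]; the threshold makes [y ^ (1 - b)] at least [A / eps]. *)
Lemma growth_sublinear (R : realType) (H : R -> R) (alpha eps : R) :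
  growth H alpha -> 0 < alpha -> alpha < 1 -> 0 < eps ->
  exists2 t0, 0 < t0 & forall y, t0 <= y -> H y <= eps * y.
Proof.
move=> HH a0 a1 e0; pose b := (alpha + 1) / 2.
have ab : alpha < b by rewrite /b; lra.
have b1 : 0 < 1 - b by rewrite /b; lra.
have c1 : 1 < 2 :> R by lra.
have hi := gt1_ltr_powR c1 ab.
have lo : 2 `^ alpha - 1 < 2 `^ alpha by lra.
have [t0 t00 Ht0] := growth_scale HH (ltr0Sn R 1) lo hi.
have [Hnd H0 _] := HH.
pose A := H (2 * t0) / t0 `^ b.
have A0 : 0 <= A by rewrite divr_ge0 ?powR_ge0.
exists (t0 + (A / eps) `^ (1 - b)^-1) => [|y yy].
  by rewrite ltr_wpDr ?powR_ge0.
have t0y : t0 <= y by have := powR_ge0 (A / eps) (1 - b)^-1; lra.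
have y0 : 0 < y by lra.
have yb : 0 < y `^ b by exact: powR_gt0.
have [|s' [ss' s'c]] :=
    geometric_descent (phi := fun t => H t / t `^ b) c1 t00 _ (lexx t0) t0y.
  move=> t tt0; have [_ _ Hc] := Ht0 t tt0.
  have t_gt0 : 0 < t by lra.
  rewrite powRM ?(ltW t_gt0)// ler_pdivrMr ?mulr_gt0 ?powR_gt0//.
  by rewrite mulrCA divfK// gt_eqF// powR_gt0.
move=> le1; have {}le1 : H y / y `^ b <= A.
  apply: le_trans le1 _; apply: ler_pM => //.
  - by rewrite invr_ge0 powR_ge0.
  - exact: Hnd.
  - rewrite lef_pV2 ?posrE ?powR_gt0//; last by lra.
    by apply: ge0_ler_powR; rewrite ?nnegrE /b; lra.
rewrite ler_pdivrMr// in le1; apply: le_trans le1 _.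
have -> : y = y `^ (1 - b) * y `^ b.
  rewrite -powRD; last by apply/implyP => _; rewrite gt_eqF.
  by rewrite subrK powRr1// ltW.
rewrite mulrA (_ : (y `^ (1 - b) * y `^ b) `^ b = y `^ b); last first.
  rewrite -powRD; last by apply/implyP => _; rewrite gt_eqF.
  by rewrite subrK powRr1// ltW.
rewrite ler_wpM2r ?(ltW yb)// mulrC -ler_pdivrMr//.
have -> : A / eps = ((A / eps) `^ (1 - b)^-1) `^ (1 - b).
  by rewrite -powRrM mulVf ?gt_eqF// powRr1// divr_ge0// ltW.
by apply: ge0_ler_powR; rewrite ?nnegrE ?powR_ge0//; lra.
Qed.

(** Discretization of the moment of [3 * X ^ 2 * expR (kappa * H X)]: the weight at [k.+1] times the
    tail at [k]. The tail wins because passing from [k.+1] to [k] costs only a factor [c] with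
    [kappa * c < 1]. *)
Lemma growth_series (R : realType) (H : R -> R) (alpha kappa : R) :
  growth H alpha -> 0 < alpha -> alpha < 1 -> 0 < kappa -> kappa < 1 ->
  (\sum_(k <oo) (3 * k.+1%:R ^+ 2 * expR (kappa * H k.+1%:R)
                 * expR (- H k%:R))%:E < +oo)%E.
Proof.
move=> HH a0 a1 k0 k1; have [Hnd H0 _] := HH.
(* Strictly between 1 and [1 / kappa]. *)
pose c := 2 / (1 + kappa); have kp : 0 < 1 + kappa by lra.
have c1 : 1 < c by rewrite ltr_pdivlMr//; lra.
pose dl := 1 - kappa * c.
have dl0 : 0 < dl.
  rewrite subr_gt0 mulrA ltr_pdivrMr//; lra.
have [t1 t10 Ht1] : exists2 t1, 0 < t1 & forall t, t1 <= t -> H (c * t) <= c * H t.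
  have hi : c `^ alpha < c.
    by rewrite -[ltRHS]powRr1 ?gt1_ltr_powR//; lra.
  have lo : c `^ alpha - 1 < c `^ alpha by lra.
  have [|t1 t10 Ht1] := growth_scale HH _ lo hi; first by lra.
  by exists t1 => // t /Ht1[].
have [t2 t20 Ht2] := growth_exp 1 HH a0 (divr_gt0 dl0 (ltr0Sn R 3)).
(* The constant is [3 * 24]: beyond 1, [k.+1 <= 2 * k] and [k.+2 <= 3 * k]. The summand [(c - 1)^-1]
   of the threshold ensures [k.+1 <= c * k]. *)
apply: (nneseries_quadratic_decay (M := 72)
  (k0 := (Num.trunc (1 + t1 + t2 + (c - 1)^-1)).+1)) => [k|k kk].
  by rewrite !mulr_ge0 ?expR_ge0// sqr_ge0.
have {}kk : 1 + t1 + t2 + (c - 1)^-1 < k%:R.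
  by apply: lt_le_trans (truncnS_gt _) _; rewrite ler_nat.
have ci0 : 0 < (c - 1)^-1 by rewrite invr_gt0; lra.
have k_ge1 : 1 <= k%:R :> R by lra.
have kc : k.+1%:R <= c * k%:R.
  have : (c - 1)^-1 <= k%:R by lra.
  rewrite -[leLHS]mul1r ler_pdivrMr; last by lra.
  by rewrite -natr1; lra.
have Hk : kappa * H k.+1%:R <= kappa * c * H k%:R.
  rewrite -mulrA ler_wpM2l ?(ltW k0)//.
  by apply: le_trans (Hnd _ _ kc) _; apply: Ht1; lra.
have Ek : expR (kappa * H k.+1%:R) * expR (- H k%:R) <= (k%:R ^+ 4)^-1.
  have k4 : k%:R ^+ 4 <= expR (dl * H k%:R).
    have := Ht2 k%:R ltac:(lra); rewrite mul1r => le1.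
    have -> : dl * H k%:R = 4%:R * (dl / 4 * H k%:R) by field.
    by rewrite expRM_natl lerXn2r ?nnegrE ?expR_ge0//; lra.
  have Q0 : 0 < k%:R ^+ 4 :> R by rewrite exprn_gt0//; lra.
  rewrite -expRD; apply: (@le_trans _ _ (expR (- (dl * H k%:R)))).
    by rewrite ler_expR /dl; lra.
  by rewrite expRN lef_pV2 ?posrE ?expR_gt0.
have kk4 : k.+1%:R ^+ 2 * (k.+1%:R * k.+2%:R) <= 24 * k%:R ^+ 4 :> R.
  have k1' : k.+1%:R <= 2 * k%:R :> R by rewrite -natr1; lra.
  have k2' : k.+2%:R <= 3 * k%:R :> R by rewrite -[k.+2%:R]natr1 -natr1; lra.
  apply: (@le_trans _ _ ((2 * k%:R) ^+ 2 * ((2 * k%:R) * (3 * k%:R)))).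
    by rewrite !ler_pM ?mulr_ge0 ?sqr_ge0 ?lerXn2r ?nnegrE ?mulr_ge0.
  by rewrite le_eqVlt; apply/orP; left; apply/eqP; ring.
rewrite -!mulrA (mulrA (expR _)).
rewrite (_ : _ * _ = 3 * (expR (kappa * H k.+1%:R) * expR (- H k%:R)) *
  (k.+1%:R ^+ 2 * (k.+1%:R * k.+2%:R))); last by ring.
have Q0 : k%:R ^+ 4 != 0 :> R by rewrite expf_neq0// gt_eqF//; lra.
rewrite (_ : 72 = 3 * (k%:R ^+ 4)^-1 * (24 * k%:R ^+ 4)); last first.
  by move: (k%:R ^+ 4) Q0 => q q0; field.
by apply: ler_pM => //; rewrite ler_wpM2l.
Qed.

(** * Sums of H along an arithmetic progression *)

Lemma growth_sum_upper (R : realType) (H : R -> R) (alpha m eps : R) :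
  growth H alpha -> 0 < alpha -> 0 < m -> 0 < eps ->
  exists2 t0, 0 < t0 & forall t, t0 <= t ->
    \sum_(n < (Num.trunc (t / m)).+1) H (t - n%:R * m)
      <= ((m * (alpha + 1))^-1 + eps) * (t * H t).
Proof.
move=> HH a0 m0 e0; have [Hnd H0 _] := HH.
have a1 : 0 < alpha + 1 by lra.
(* About [t / m] terms, each off by [e' * H t], lose half of [eps * t * H t]; the other half covers
   the term [n = 0] and the extra [e']. *)
pose e' := eps * m / 2.
have e'0 : 0 < e' by rewrite divr_gt0// mulr_gt0.
have [t0 t00 Ht0] := growth_uniform HH a0 e'0.
exists (t0 + 2 * (1 + e') / eps) => [|t tt].
  by apply: addr_gt0 => //; rewrite divr_gt0//; lra.
have q0 : 0 < 2 * (1 + e') / eps by rewrite divr_gt0//; lra.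
have t_gt0 : 0 < t by lra.
set M := Num.trunc (t / m); pose h := m / t.
have h0 : 0 < h by rewrite divr_gt0.
have ht : h * t = m by rewrite /h divfK// gt_eqF.
have Mt : M%:R <= t / m.
  by have /andP[] := truncn_itv (ltW (divr_gt0 t_gt0 m0)).
have Mh : M%:R * h <= 1.
  by rewrite mulrA ler_pdivrMr// mul1r -ler_pdivlMr.
have := riemann_sum_upper a0 h0 Mh.
set S := \sum_(n < M.+1) _ => hS.
apply: (@le_trans _ _ ((S + M.+1%:R * e') * H t)).
  rewrite (_ : S + M.+1%:R * e' = \sum_(n < M.+1) ((1 - n%:R * h) `^ alpha + e')).
    rewrite mulr_suml; apply: ler_sum => n _.
    have nM : n%:R * h <= 1.
      by apply: le_trans Mh; rewrite ler_pM2r// ler_nat -ltnS.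
    have nh0 : 0 <= n%:R * h by rewrite mulr_ge0// ltW.
    have := Ht0 t (1 - n%:R * h) ltac:(lra) ltac:(lra) ltac:(lra).
    by rewrite (_ : _ * t = t - n%:R * m) => [/andP[]//|]; rewrite mulrBl mul1r -mulrA ht.
  by rewrite big_split/= sumr_const card_ord mulr_natl.
rewrite [leRHS]mulrA ler_wpM2r//.
have {}hS : S <= 1 + (alpha + 1)^-1 * (t / m).
  rewrite -(ler_pM2l h0); apply: le_trans hS _.
  rewrite le_eqVlt; apply/orP; left; apply/eqP.
  by rewrite /h; field; rewrite !gt_eqF.
have et : 2 * (1 + e') <= eps * t.
  by rewrite [leRHS]mulrC -ler_pdivrMr//; lra.
have e't : e' * (t / m) = eps * t / 2 by rewrite /e'; field; rewrite gt_eqF.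
have : M.+1%:R * e' <= (t / m + 1) * e'.
  by rewrite ler_wpM2r ?(ltW e'0)// -natr1 lerD2r.
have -> : ((m * (alpha + 1))^-1 + eps) * t = (alpha + 1)^-1 * (t / m) + eps * t.
  by field; rewrite !gt_eqF.
by lra.
Qed.

(** The sum stops at [(1 - eps) * t / m] because the large deviation bound needs arguments of [H]
    comparable to [t]. *)
Lemma growth_sum_lower (R : realType) (H : R -> R) (alpha m eps : R) :
  growth H alpha -> 0 < alpha -> 0 < m -> 0 < eps -> eps < 1 ->
  exists2 t0, 0 < t0 & forall t, t0 <= t ->
    ((1 - eps) * (m * (alpha + 1))^-1 - eps) * (t * H t)
      <= \sum_(n < Num.trunc ((1 - eps) * t / m)) H (t - n.+1%:R * m).
Proof.
move=> HH a0 m0 e0 e1; have [Hnd H0 _] := HH.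
have a1 : 0 < alpha + 1 by lra.
pose e' := eps * m / 2.
have e'0 : 0 < e' by rewrite divr_gt0// mulr_gt0.
have [t0 t00 Ht0] := growth_uniform HH a0 e'0.
exists (t0 + 2 / eps + m / eps) => [|t tt].
  by rewrite !addr_gt0// divr_gt0.
have q1 : 0 < 2 / eps by rewrite divr_gt0.
have q2 : 0 < m / eps by rewrite divr_gt0.
have t_gt0 : 0 < t by lra.
set M := Num.trunc _; pose h := m / t.
have h0 : 0 < h by rewrite divr_gt0.
have et0 : 0 <= (1 - eps) * t / m.
  by rewrite divr_ge0 ?(ltW m0)// mulr_ge0 ?(ltW t_gt0)//; lra.
have /andP[Mt tM] := truncn_itv et0; rewrite -/M in Mt tM.
have mt : m <= eps * t by rewrite [leRHS]mulrC -ler_pdivrMr//; lra.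
have et : 2 <= eps * t by rewrite [leRHS]mulrC -ler_pdivrMr//; lra.
have ht : h * t = m by rewrite /h divfK// gt_eqF.
have Mm : M%:R * m <= (1 - eps) * t by rewrite -ler_pdivlMr.
have Mm' : (1 - eps) * t < M.+1%:R * m by rewrite -ltr_pdivrMr.
have Mh : M.+1%:R * h <= 1.
  by rewrite mulrA ler_pdivrMr// mul1r -natr1 mulrDl mul1r; lra.
have Mh' : 1 - eps < M.+1%:R * h by rewrite mulrA ltr_pdivlMr.
have := riemann_sum_lower a0 h0 Mh.
set S := \sum_(n < M) _ => hS.
apply: (@le_trans _ _ ((S - M%:R * e') * H t)); last first.
  rewrite (_ : S - M%:R * e' = \sum_(n < M) ((1 - n.+1%:R * h) `^ alpha - e')).
    rewrite mulr_suml; apply: ler_sum => n _.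
    have nM : n.+1%:R * h <= 1.
      by apply: le_trans Mh; rewrite ler_pM2r// ler_nat ltnS ltnW.
    have nh0 : 0 <= n.+1%:R * h by rewrite mulr_ge0// ltW.
    have := Ht0 t (1 - n.+1%:R * h) ltac:(lra) ltac:(lra) ltac:(lra).
    by rewrite (_ : _ * t = t - n.+1%:R * m) => [/andP[]//|]; rewrite mulrBl mul1r -mulrA ht.
  by rewrite big_split/= sumrN sumr_const card_ord mulr_natl.
rewrite [leLHS]mulrA ler_wpM2r//.
have h1 : h <= 1.
  by apply: le_trans Mh; rewrite ler_peMl ?(ltW h0)// ler1n.
have {}hS : (1 - eps) * (alpha + 1)^-1 * (t / m) - 1 <= S.
  rewrite -(ler_pM2l h0); apply: le_trans hS.
  have le1 : - h <= ((1 - h) `^ (alpha + 1) - 1) / (alpha + 1).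
    have := @powR_tangent _ alpha 1 (1 - h) a0 ltac:(lra) ltac:(lra).
    by rewrite !powR1 mul1r; lra.
  (* The missing end of the interval is shorter than [eps], and a power above 1 only shrinks it.
     [ge1r_powR] asks for a positive base, hence the case distinction. *)
  have le2 : (1 - M.+1%:R * h) `^ (alpha + 1) <= eps.
    have [->|M1] := eqVneq (1 - M.+1%:R * h) 0.
      by rewrite powR0 ?gt_eqF// ltW.
    apply: (@le_trans _ _ (1 - M.+1%:R * h)); last by lra.
    have M2 : 0 <= M.+1%:R * h by rewrite mulr_ge0// ltW.
    by apply: ge1r_powR; [rewrite lt_neqAle eq_sym M1 /=; lra|lra].
  have le3 : (1 - M.+1%:R * h) `^ (alpha + 1) / (alpha + 1) <= eps / (alpha + 1).
    by rewrite ler_wpM2r// invr_ge0 ltW.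
  have -> : h * ((1 - eps) * (alpha + 1)^-1 * (t / m) - 1)
      = (alpha + 1)^-1 - eps / (alpha + 1) - h.
    by rewrite /h; field; rewrite !gt_eqF.
  by rewrite !mulrBl mul1r in le1 *; lra.
have Mle : M%:R * e' <= (t / m) * e'.
  rewrite ler_wpM2r ?(ltW e'0)// ler_pdivlMr//; apply: le_trans Mm _.
  by have := mulr_gt0 e0 t_gt0; lra.
have e't : t / m * e' = eps * t / 2 by rewrite /e'; field; rewrite gt_eqF.
have -> : ((1 - eps) * (m * (alpha + 1))^-1 - eps) * t
    = (1 - eps) * (alpha + 1)^-1 * (t / m) - eps * t.
  by field; rewrite !gt_eqF.
by lra.
Qed.

(** * Geometric sums and products *)

Lemma geometric_sum_le (R : realType) (q : R) (N : nat) : 0 <= q -> q < 1 ->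
  \sum_(0 <= n < N) q ^+ n <= (1 - q)^-1.
Proof.
move=> q0 q1; rewrite -div1r ler_pdivlMr; last by lra.
suff -> : (\sum_(0 <= n < N) q ^+ n) * (1 - q) = 1 - q ^+ N.
  by rewrite gerBl exprn_ge0.
elim: N => [|N IH]; first by rewrite big_geq// expr0 subrr mul0r.
by rewrite big_nat_recr//= mulrDl IH exprS; ring.
Qed.

(** The bound does not depend on [N], by summability of [q ^ n]. At [n = 0] the loss is set to 0,
    since [q ^ 0 = 1] would annihilate the product; no law of large numbers is invoked for that
    factor. *)
Lemma geometric_product_ge (R : realType) (q : R) (N : nat) : 0 < q -> q < 1 ->
  expR (- (1 - q)^-1 ^+ 2)
    <= \prod_(0 <= n < N) (1 - (if n == 0%N then 0 else q ^+ n)).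
Proof.
move=> q0 q1; have q1' : 0 < 1 - q by lra.
apply: (@le_trans _ _ (\prod_(0 <= n < N) expR (- (q ^+ n / (1 - q))))).
  rewrite -expR_sum ler_expR sumrN lerN2 -mulr_suml expr2.
  by rewrite ler_wpM2r ?invr_ge0 ?(ltW q1')// geometric_sum_le// ltW.
apply: ler_prod => n _; rewrite expR_ge0 /=; have [->|n0] := eqVneq n 0%N.
  by rewrite subr0 expR_le1 oppr_le0 divr_ge0 ?exprn_ge0// ltW.
have qn : q ^+ n <= q.
  by case: n n0 => // n _; rewrite exprS ler_piMr ?(ltW q0)// exprn_ile1 ?ltW.
have qn0 : 0 <= q ^+ n by rewrite exprn_ge0// ltW.
have u1 : 1 - q ^+ n != 0 by rewrite gt_eqF//; lra.
(* This is [1 - x >= expR (- (x / (1 - x)))] at [x = q ^ n], the inverse of [1 + u <= expR u] at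
   [u = x / (1 - x)]. *)
apply: (@le_trans _ _ (expR (- (q ^+ n / (1 - q ^+ n))))).
  by rewrite ler_expR lerN2 ler_wpM2l// lef_pV2 ?posrE; lra.
rewrite expRN -[leRHS]invrK lef_pV2 ?posrE ?expR_gt0//; last first.
  by rewrite invr_gt0; lra.
apply: le_trans (expR_ge1Dx _); rewrite le_eqVlt; apply/orP; left; apply/eqP.
by move: (q ^+ n) u1 => x x1; field.
Qed.

(** * Deviations of partial sums *)

Section SumBounds.
Context (d : measure_display) (T : measurableType d) (R : realType)
  (P : probability T R).

Lemma measurable_partial_sum (X : nat -> {RV P >-> R}) (n : nat) :
  measurable_fun setT (partial_sum X n).
Proof. by apply: measurable_sum => i; exact: measurable_funP. Qed.

Lemma measurable_gt (f : T -> R) (t : R) : measurable_fun setT f ->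
  measurable [set x | t < f x].
Proof.
move=> mf; rewrite [X in measurable X](_ : _ = f @^-1` `]t, +oo[); last first.
  by apply/seteqP; split => x /=; rewrite in_itv /= andbT.
by rewrite -[X in measurable X]setTI; exact: mf.
Qed.

Lemma measurable_ray (X : {RV P >-> R}) (t : R) : measurable [set x | t < X x].
Proof. by apply: measurable_gt; exact: measurable_funP. Qed.

Lemma iid_integral_prod (X : nat -> {RV P >-> R}) (f : R -> R) (M : R) (n : nat) :
  iid X -> measurable_fun setT f -> (forall y, 0 <= f y) ->
  (\int[P]_x (f (X 0%N x))%:E <= M%:E)%E ->
  (\int[P]_x (\prod_(1 <= i < n.+1) f (X i x))%:E <= (M ^+ n)%:E)%E.
Proof.
move=> [indep law] mf f0 fM.
have E i : (\int[P]_x (f (X i x))%:E = \int[P]_x (f (X 0%N x))%:E)%E.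
  by apply: same_law_integral => //; exact: law.
rewrite (indep_integral_prod (f := fun=> f)) ?iota_uniq//; last first.
  by move=> i; rewrite E (le_lt_trans fM)// ltry.
elim: n => [|n IH]; first by rewrite big_geq.
rewrite big_nat_recr//= exprSr EFinM lee_pmul ?E//.
  by apply: prode_ge0 => i _; apply: integral_ge0 => x _; rewrite lee_fin.
by apply: integral_ge0 => x _; rewrite lee_fin.
Qed.

(* Either some summand exceeds [y], or the sum of the truncated summands does
   the work and Chernoff's bound applies to it. *)
Lemma partial_sum_upper_tail (X : nat -> {RV P >-> R}) (n : nat)
    (t y lambda M p : R) : iid X -> 0 <= lambda ->
  (P [set x | (y < X 0%N x)%R] <= p%:E)%E ->
  (\int[P]_x (expR (lambda * X 0%N x) * \1_(`]-oo, y]) (X 0%N x))%:E <= M%:E)%E ->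
  (P [set x | (t < partial_sum X n x)%R]
     <= (n%:R * p + expR (- (lambda * t)) * M ^+ n)%:E)%E.
Proof.
move=> iidX l0 Pp IM.
pose f s := expR (lambda * s) * \1_(`]-oo, y]) s : R.
have mf : measurable_fun setT f.
  apply: measurable_funM; last exact: measurable_indic.
  by apply: measurableT_comp => //; exact: measurable_funM.
have f0 s : 0 <= f s by rewrite mulr_ge0// expR_ge0.
have mS := measurable_gt t (measurable_partial_sum X n).
rewrite -[X in (P X <= _)%E]setIT -integral_indic//.
pose B i := [set x | y < X i x].
have mB i : measurable (B i) by exact: measurable_ray.
have PB i : (P (B i) <= p%:E)%E.
  have [_ /(_ i 0%N) law] := iidX.
  by apply: le_trans Pp; rewrite /B -!preimage_itvoy law.
pose U x := \sum_(1 <= i < n.+1) \1_(B i) x : R.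
pose V x := expR (- (lambda * t)) * \prod_(1 <= i < n.+1) f (X i x).
have mU : measurable_fun setT U.
  by apply: measurable_sum => i; exact: measurable_indic.
have mprod : measurable_fun setT (fun x => \prod_(1 <= i < n.+1) f (X i x)).
  exact: (@measurable_prod_comp _ _ _ _ X (fun=> f)).
have mV : measurable_fun setT V by exact: measurable_funM.
have prod0 x : 0 <= \prod_(1 <= i < n.+1) f (X i x) by exact: prodr_ge0.
have U0 x : 0 <= U x by rewrite /U sumr_ge0.
have V0 x : 0 <= V x by rewrite mulr_ge0 ?expR_ge0.
apply: (@le_trans _ _ (\int[P]_x ((U x)%:E + (V x)%:E)))%E.
  apply: ge0_le_integral => //.
  - by apply/measurable_EFinP; exact: measurable_indic.
  - by apply: emeasurable_funD; apply/measurable_EFinP.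
  - move=> x _; rewrite -EFinD lee_fin indicE.
    have [|_] := boolP (x \in _); last by rewrite addr_ge0.
    rewrite inE /= => tS.
    have [[i [i1 yi]]|nB] := pselect (exists i, (1 <= i < n.+1)%N /\ y < X i x).
      rewrite -[leLHS]addr0 lerD// /U.
      rewrite (bigD1_seq i) ?mem_index_iota ?iota_uniq//= indicE mem_set//.
      by rewrite lerDl sumr_ge0.
    rewrite -[leLHS]add0r lerD// /V.
    have -> : \prod_(1 <= i < n.+1) f (X i x) = expR (lambda * partial_sum X n x).
      rewrite /partial_sum mulr_sumr expR_sum.
      apply: eq_big_nat => i i1; rewrite /f indicE mem_set ?mulr1//= in_itv /=.
      by rewrite leNgt; apply/negP => yi; apply: nB; exists i.
    rewrite -expRD -expR0 ler_expR addrC subr_ge0 ler_wpM2l//.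
    exact: ltW.
rewrite ge0_integralD//; last 4 first.
- by move=> x _; rewrite lee_fin.
- exact/measurable_EFinP.
- by move=> x _; rewrite lee_fin.
- exact/measurable_EFinP.
rewrite EFinD leeD//.
  under eq_integral do rewrite -sumEFin.
  rewrite ge0_integral_sum//; last first.
    by move=> i; apply/measurable_EFinP; exact: measurable_indic.
  apply: (@le_trans _ _ (\sum_(1 <= i < n.+1) p%:E)%E).
    by apply: lee_sum => i _; rewrite integral_indic// setIT; exact: PB.
  by rewrite sumEFin big_const_nat iter_addr addr0 subSS subn0 mulr_natl.
under eq_integral do rewrite EFinM.
rewrite ge0_integralZl_EFin ?expR_ge0//; last 2 first.
- by move=> x _; rewrite lee_fin.
- exact/measurable_EFinP.
rewrite EFinM lee_pmul2l ?lte_fin ?expR_gt0//.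
exact: iid_integral_prod.
Qed.
End SumBounds.

Section Moments.
Context (d : measure_display) (T : measurableType d) (R : realType)
  (P : probability T R).

(** The last summand makes the jump. Independently of it, the other [n] summands stay below [b] with
    probability at most [expR (lambda * b) * M ^ n], by Chernoff's bound for the lower tail. *)
Lemma partial_sum_lower_tail (X : nat -> {RV P >-> R}) (n : nat)
    (a b lambda M p : R) : iid X ->
  P [set x | (a < X 0%N x)%R] = p%:E ->
  (\int[P]_x (expR (- (lambda * X 0%N x)))%:E <= M%:E)%E -> 0 <= lambda ->
  ((p * (1 - expR (lambda * b) * M ^+ n))%:E
     <= P [set x | (a + b < partial_sum X n.+1 x)%R])%E.
Proof.
move=> iidX Pa IM l0; have [indep law] := iidX.
(* Jump indicator in the last factor, Laplace factors before it: the product, times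
   [expR (lambda * b)], dominates the event that the jump occurs and the others fall short. *)
pose f i s : R := if i == n.+1 then \1_(`]a, +oo[) s else expR (- (lambda * s)).
have mexp : measurable_fun setT (fun s : R => expR (- (lambda * s))).
  under eq_fun do rewrite -mulNr.
  by apply: measurableT_comp => //; exact: measurable_funM.
have mf i : measurable_fun setT (f i).
  by rewrite /f; case: eqP => _ //; exact: measurable_indic.
have f0 i s : 0 <= f i s by rewrite /f; case: eqP => _ //; exact: expR_ge0.
have mX i : measurable_fun setT (X i) by exact: measurable_funP.
have mA i : measurable [set x | a < X i x] by exact: measurable_ray.
have PA i : P [set x | a < X i x] = p%:E.
  by rewrite -Pa -!preimage_itvoy (law i 0%N).
have If : (\int[P]_x (f n.+1 (X n.+1 x))%:E = p%:E)%E.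
  rewrite -(PA n.+1) -[X in _ = P X]setIT -integral_indic//.
  by apply: eq_integral => x _; rewrite /f eqxx -preimage_itvoy.
have Ie i : (\int[P]_x (expR (- (lambda * X i x)))%:E <= M%:E)%E.
  rewrite (same_law_integral (law i 0%N) mexp)// => s; exact: expR_ge0.
have ffin i : (\int[P]_x (f i (X i x))%:E < +oo)%E.
  have [->|ni] := eqVneq i n.+1; first by rewrite If ltry.
  apply: le_lt_trans (ltry M); rewrite /f (negbTE ni); exact: Ie.
pose g x := \prod_(1 <= i < n.+2) f i (X i x).
have mg : measurable_fun setT g by exact: (@measurable_prod_comp _ _ _ _ X f).
have g0 x : 0 <= g x by exact: prodr_ge0.
have M0 : 0 <= M.
  rewrite -lee_fin; apply: le_trans (Ie 0%N); apply: integral_ge0 => x _.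
  by rewrite lee_fin expR_ge0.
have p0 : 0 <= p by rewrite -lee_fin -(PA 0%N).
have Ig : (\int[P]_x (g x)%:E <= (M ^+ n * p)%:E)%E.
  rewrite indep_integral_prod ?iota_uniq// big_nat_recr//= If EFinM.
  rewrite lee_pmul//.
  - by apply: prode_ge0 => i _; apply: integral_ge0 => x _; rewrite lee_fin.
  rewrite (eq_big_nat _ _ (F2 := fun i => \int[P]_x (expR (- (lambda * X i x)))%:E)%E).
    rewrite -(@indep_integral_prod _ _ _ _ X (fun=> fun s => expR (- (lambda * s)))) ?iota_uniq//.
    - exact: (@iid_integral_prod _ _ _ _ X (fun s => expR (- (lambda * s)))).
    - by move=> i; apply: le_lt_trans (ltry M).
  by move=> i /andP[_ iN]; rewrite /f ltn_eqF.
pose c := expR (lambda * b).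
have c0 : 0 <= c by exact: expR_ge0.
have mS := measurable_gt (a + b) (measurable_partial_sum X n.+1).
have : (p%:E <= P [set x | (a + b < partial_sum X n.+1 x)%R] + (c * (M ^+ n * p))%:E)%E.
  rewrite -(PA n.+1) -[X in (P X <= _)%E]setIT -integral_indic//.
  rewrite -[X in (_ <= P X + _)%E]setIT -integral_indic//.
  apply: (@le_trans _ _ (\int[P]_x
    ((\1_[set x | a + b < partial_sum X n.+1 x] x)%:E + (c * g x)%:E)))%E.
    apply: ge0_le_integral => //.
    - by apply/measurable_EFinP; exact: measurable_indic.
    - apply: emeasurable_funD; first by apply/measurable_EFinP; exact: measurable_indic.
      by apply/measurable_EFinP; exact: measurable_funM.
    - move=> x _; rewrite -EFinD lee_fin !indicE.
      have [|_] := boolP (x \in [set x | a < X n.+1 x]); last by rewrite addr_ge0 ?mulr_ge0.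
      rewrite inE /= => aX.
      have gE : g x = expR (- (lambda * partial_sum X n x)).
        rewrite /g big_nat_recr//= {2}/f eqxx indicE mem_set ?mulr1; last first.
          by rewrite /= in_itv /= aX.
        rewrite /partial_sum mulr_sumr -sumrN expR_sum.
        by apply: eq_big_nat => i /andP[_ iN]; rewrite /f ltn_eqF.
      have [bS|Sb] := ltP (partial_sum X n x) b.
        rewrite -[leLHS]add0r lerD// gE /c -expRD -expR0 ler_expR subr_ge0.
        by rewrite ler_wpM2l// ltW.
      rewrite mem_set; first by rewrite lerDl mulr_ge0.
      by rewrite /= /partial_sum big_nat_recr//= addrC ltr_leD.
  rewrite ge0_integralD//; last 3 first.
  - by apply/measurable_EFinP; exact: measurable_indic.
  - by move=> x _; rewrite lee_fin mulr_ge0.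
  - by apply/measurable_EFinP; exact: measurable_funM.
  rewrite leeD2l//; under eq_integral do rewrite EFinM.
  rewrite ge0_integralZl_EFin//; last 2 first.
  - by move=> x _; rewrite lee_fin.
  - exact/measurable_EFinP.
  by rewrite EFinM lee_wpmul2l.
rewrite -[P _]fineK ?fin_num_measure// -EFinD !lee_fin.
by rewrite mulrBr mulr1 (mulrC p) mulrA /c; lra.
Qed.

(** On [k < X <= k.+1] the single term [k] of the series already dominates [f X]. These intervals
    miss 0, hence the requirement [f 0 = 0]. *)
Lemma integral_le_tail_series (X : {RV P >-> R}) (f : R -> R) (w : nat -> R) :
  {ae P, forall x, 0 <= X x} -> measurable_fun setT f ->
  (forall s, 0 <= f s) -> f 0 = 0 -> (forall k, 0 <= w k) ->
  (forall s k, k%:R < s -> s <= k.+1%:R -> f s <= w k) ->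
  (\int[P]_x (f (X x))%:E
     <= \sum_(k <oo) (w k)%:E * P [set x | (k%:R < X x)%R])%E.
Proof.
move=> X0 mf f0 f00 w0 fw.
pose A k := [set x | k%:R < X x].
have mA k : measurable (A k) by exact: measurable_ray.
pose h k x := (w k * \1_(A k) x)%:E.
have h0 k x : (0 <= h k x)%E by rewrite lee_fin mulr_ge0.
have mh k : measurable_fun setT (h k).
  by apply/measurable_EFinP; apply: measurable_funM => //; exact: measurable_indic.
apply: (@le_trans _ _ (\int[P]_x \sum_(k <oo) h k x))%E; last first.
  rewrite integral_nneseries//; apply: lee_nneseries => k _.
    by move=> _; apply: integral_ge0.
  under eq_integral do rewrite /h EFinM.
  rewrite ge0_integralZl_EFin//; last by apply/measurable_EFinP; exact: measurable_indic.
  by rewrite integral_indic// setIT.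
apply: ae_ge0_le_integral => //.
- by move=> x _; rewrite lee_fin.
- by apply/measurable_EFinP; apply: measurableT_comp => //; exact: measurable_funP.
- by move=> x _; exact: nneseries_ge0.
- exact: ge0_emeasurable_sum.
apply: filterS X0 => x Xx _.
have [->|X0] := eqVneq (X x) 0; first by rewrite f00; exact: nneseries_ge0.
(* Truncation uses intervals closed on the left, so a positive integer value moves to the preceding
   [k]. *)
have [k [kX Xk]] : exists k : nat, k%:R < X x /\ X x <= k.+1%:R.
  have /andP[] := truncn_itv Xx; case: (Num.trunc (X x)) => [|k] lo hi.
    by exists 0%N; split; [rewrite lt0r X0|exact: ltW].
  move: lo; rewrite le_eqVlt => /orP[/eqP <-|lo]; last by exists k.+1; split => //; exact: ltW.
  by exists k; rewrite ltr_nat ltnSn lexx.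
apply: (@le_trans _ _ (h k x)).
  by rewrite lee_fin indicE mem_set// mulr1; exact: fw.
apply: le_trans (nneseries_lim_ge k.+1 _) => //.
by rewrite big_nat_recr//= leeDr// sume_ge0.
Qed.

(** The tail [expR (- H)] outweighs [expR (kappa * H)] for [kappa < 1]. This moment dominates the
    second-order remainder of the exponential of [X] at all truncation levels at once. *)
Lemma exp_weighted_moment (X : {RV P >-> R}) (H : R -> R) (alpha kappa : R) :
  growth H alpha -> 0 < alpha -> alpha < 1 -> 0 < kappa -> kappa < 1 ->
  {ae P, forall x, 0 <= X x} ->
  (forall t, P [set x | t < X x] = (expR (- H t))%:E) ->
  exists C, (\int[P]_x (3 * X x ^+ 2 * expR (kappa * H (X x)))%:E <= C%:E)%E.
Proof.
move=> HH a0 a1 k0 k1 X0 PX; have [Hnd H0 _] := HH.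
have := growth_series HH a0 a1 k0 k1.
set S := (X in (X < _)%E -> _) => Sfin.
have S0 : (0 <= S)%E.
  by apply: nneseries_ge0 => k _ _; rewrite lee_fin !mulr_ge0 ?expR_ge0 ?sqr_ge0.
exists (fine S); rewrite fineK ?ge0_fin_numE//.
apply: le_trans (@integral_le_tail_series X (fun s => 3 * s ^+ 2 * expR (kappa * H s))
  (fun k => 3 * k.+1%:R ^+ 2 * expR (kappa * H k.+1%:R)) X0 _ _ _ _ _) _.
- apply: measurable_funM; first by apply: measurable_funM.
  apply: measurableT_comp => //; apply: measurable_funM => //.
  by apply: nondecreasing_measurable.
- by move=> s; rewrite mulr_ge0 ?expR_ge0// mulr_ge0// sqr_ge0.
- by rewrite expr0n mulr0 mul0r.
- by move=> k; rewrite !mulr_ge0 ?expR_ge0 ?sqr_ge0.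
- move=> s k ks sk; have s0 : 0 <= s by apply: le_trans (ltW ks).
  rewrite ler_pM ?expR_ge0//; first by rewrite mulr_ge0// sqr_ge0.
    by rewrite ler_wpM2l// lerXn2r ?nnegrE.
  by rewrite ler_expR ler_wpM2l ?(ltW k0)//; exact: Hnd.
by rewrite le_eqVlt; apply/orP; left; apply/eqP; apply: eq_eseriesr => k _; rewrite PX EFinM.
Qed.
End Moments.

(** Multiply [(1 - u) * expR u <= 1] by [1 + u]. *)
Lemma expR_le_quadratic (R : realType) (u : R) : 0 <= u ->
  expR u <= 1 + u + u ^+ 2 * expR u.
Proof.
move=> u0; have := expR_ge1Dx (- u); rewrite expRN => le1.
have E0 := expR_gt0 u.
have : (1 - u) * expR u <= 1 by rewrite -ler_pdivlMr// mul1r.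
by move=> le2; have : (1 + u) * ((1 - u) * expR u) <= (1 + u) * 1;
  [rewrite ler_wpM2l//; lra|lra].
Qed.

Lemma expRN_le_quadratic (R : realType) (u : R) : 0 <= u ->
  expR (- u) <= 1 - u + u ^+ 2.
Proof.
move=> u0; rewrite expRN; have := expR_ge1Dx u => le1.
apply: (@le_trans _ _ (1 + u)^-1).
  by rewrite lef_pV2 ?posrE ?expR_gt0//; lra.
rewrite -div1r ler_pdivrMr; last by lra.
have -> : (1 - u + u ^+ 2) * (1 + u) = 1 + u ^+ 3 by ring.
by rewrite lerDl exprn_ge0.
Qed.

(** * Exponential moments and the two tail estimates for sums *)

Section MomentGenerating.
Context (d : measure_display) (T : measurableType d) (R : realType)
  (P : probability T R).

Lemma integral_affine_le (g h : T -> R) (a b G K : R) :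
  measurable_fun setT g -> measurable_fun setT h ->
  (forall x, 0 <= g x) -> (forall x, 0 <= h x) -> 0 <= a -> 0 <= b ->
  (\int[P]_x (g x)%:E <= G%:E)%E -> (\int[P]_x (h x)%:E <= K%:E)%E ->
  (\int[P]_x (1 + a * g x + b * h x)%:E <= (1 + a * G + b * K)%:E)%E.
Proof.
move=> mg mh g0 h0 a0 b0 gG hK.
have meg : measurable_fun setT (fun x => (g x)%:E) by exact/measurable_EFinP.
have meh : measurable_fun setT (fun x => (h x)%:E) by exact/measurable_EFinP.
have Z c f : 0 <= c -> (forall x, 0 <= f x) -> measurable_fun setT (fun x => (f x)%:E) ->
    (\int[P]_x (c%:E * (f x)%:E) = c%:E * \int[P]_x (f x)%:E)%E.
  by move=> c0 f0 mf; rewrite ge0_integralZl_EFin// => x _; rewrite lee_fin.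
have ea0 x : (0 <= a%:E * (g x)%:E)%E by rewrite -EFinM lee_fin mulr_ge0.
have eb0 x : (0 <= b%:E * (h x)%:E)%E by rewrite -EFinM lee_fin mulr_ge0.
under eq_integral do rewrite !EFinD !EFinM.
rewrite ge0_integralD//; last 3 first.
- by move=> x _; rewrite adde_ge0.
- by apply: emeasurable_funD => //; exact: measurable_funeM.
- exact: measurable_funeM.
rewrite ge0_integralD//; last exact: measurable_funeM.
rewrite (_ : \int[P]_x 1%:E = 1)%E; last first.
  by rewrite integral_cst// [X in (_ * X)%E](@probability_setT _ _ _ P) mule1.
rewrite !Z// !EFinD !EFinM.
by rewrite !leeD// lee_wpmul2l.
Qed.

(** In the remainder [(lambda * X) ^ 2 * expR (lambda * X)] the exponential is traded for the
    integrable weight, which truncation at [y] permits. Negative values of [X] are harmless, the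
    exponential being at most 1 there. *)
Lemma mgf_truncated_le (X : {RV P >-> R}) (H : R -> R) (kappa lambda y m C : R) :
  {homo H : s t / s <= t} -> 0 <= lambda ->
  (forall s, 0 <= s -> s <= y -> expR (lambda * s) <= 3 * expR (kappa * H s)) ->
  (\int[P]_x (`|X x|)%:E <= m%:E)%E ->
  (\int[P]_x (3 * X x ^+ 2 * expR (kappa * H (X x)))%:E <= C%:E)%E ->
  (\int[P]_x (expR (lambda * X x) * \1_(`]-oo, y]) (X x))%:E
     <= (1 + lambda * m + lambda ^+ 2 * C)%:E)%E.
Proof.
move=> Hnd l0 lH Xm XC.
have mX : measurable_fun setT X by exact: measurable_funP.
have mH : measurable_fun setT H by exact: nondecreasing_measurable.
have mn : measurable_fun setT (fun x => `|X x|) by exact: measurableT_comp.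
have mf : measurable_fun setT (fun x => 3 * X x ^+ 2 * expR (kappa * H (X x))).
  apply: measurable_funM.
    by apply: measurable_funM => //; exact: measurable_funX.
  apply: measurableT_comp => //; apply: measurable_funM => //.
  exact: measurableT_comp.
have f0 x : 0 <= 3 * X x ^+ 2 * expR (kappa * H (X x)).
  by rewrite mulr_ge0 ?expR_ge0// mulr_ge0// sqr_ge0.
apply: le_trans (integral_affine_le mn mf _ f0 l0 (sqr_ge0 lambda) Xm XC) => //.
apply: ge0_le_integral => //.
- apply/measurable_EFinP; apply: measurable_funM.
    by apply: measurableT_comp => //; exact: measurable_funM.
  by apply: measurableT_comp => //; exact: measurable_indic.
- apply/measurable_EFinP; apply: measurable_funD; last exact: measurable_funM.
  by apply: measurable_funD => //; exact: measurable_funM.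
- move=> x _; rewrite lee_fin indicE.
  have n0 := mulr_ge0 l0 (normr_ge0 (X x)).
  have q0 := mulr_ge0 (sqr_ge0 lambda) (f0 x).
  have [|_] := boolP (X x \in _); last by rewrite mulr0; lra.
  rewrite inE /= in_itv /= mulr1 => Xy.
  have [X0|X0] := leP 0 (X x); last first.
    have : expR (lambda * X x) <= 1 by rewrite expR_le1 mulr_ge0_le0// ltW.
    lra.
  apply: le_trans (expR_le_quadratic (mulr_ge0 l0 X0)) _.
  rewrite ger0_norm// lerD2l exprMn.
  rewrite [leRHS](_ : _ = lambda ^+ 2 * X x ^+ 2 * (3 * expR (kappa * H (X x)))); last by ring.
  by rewrite ler_wpM2l//; [rewrite mulr_ge0// sqr_ge0|exact: lH].
Qed.

Lemma laplace_le (X : {RV P >-> R}) (lambda m C : R) :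
  {ae P, forall x, 0 <= X x} -> 0 <= lambda ->
  (\int[P]_x (`|X x|)%:E = m%:E)%E -> (\int[P]_x (X x ^+ 2)%:E <= C%:E)%E ->
  (\int[P]_x (expR (- (lambda * X x)))%:E
     <= (1 - lambda * m + lambda ^+ 2 * C)%:E)%E.
Proof.
move=> X0 l0 Xm XC.
have mX : measurable_fun setT X by exact: measurable_funP.
have mn : measurable_fun setT (fun x => `|X x|) by exact: measurableT_comp.
have m2 : measurable_fun setT (fun x => X x ^+ 2) by exact: measurable_funX.
have me : measurable_fun setT (fun x => expR (- (lambda * X x))).
  under eq_fun do rewrite -mulNr.
  by apply: measurableT_comp => //; exact: measurable_funM.
have le1 := integral_affine_le m2 m2 (fun x => sqr_ge0 _) (fun x => sqr_ge0 _)
  (sqr_ge0 lambda) (lexx 0) XC XC.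
rewrite mul0r addr0 in le1.
(* The linear term is moved to the left so that all integrands are nonnegative. *)
have : (\int[P]_x ((expR (- (lambda * X x)))%:E + (lambda * `|X x|)%:E)
   <= (1 + lambda ^+ 2 * C)%:E)%E.
  apply: le_trans le1; apply: ae_ge0_le_integral => //.
  - by move=> x _; rewrite -EFinD lee_fin addr_ge0 ?expR_ge0// mulr_ge0.
  - by apply: emeasurable_funD; apply/measurable_EFinP => //; exact: measurable_funM.
  - by move=> x _; rewrite lee_fin mul0r addr0 addr_ge0// mulr_ge0 ?sqr_ge0.
  - apply/measurable_EFinP; apply: measurable_funD; last exact: measurable_funM.
    by apply: measurable_funD => //; exact: measurable_funM.
  apply: filterS X0 => x Xx _; rewrite -EFinD lee_fin ger0_norm//.
  have := expRN_le_quadratic (mulr_ge0 l0 Xx); rewrite exprMn; lra.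
rewrite ge0_integralD//; last 3 first.
- exact/measurable_EFinP.
- by move=> x _; rewrite lee_fin mulr_ge0.
- by apply/measurable_EFinP; exact: measurable_funM.
have -> : (\int[P]_x (lambda * `|X x|)%:E = (lambda * m)%:E)%E.
  under eq_integral do rewrite EFinM.
  rewrite ge0_integralZl_EFin ?Xm//; exact/measurable_EFinP.
rewrite -leeBrDr// -EFinB => /le_trans; apply.
by rewrite lee_fin; lra.
Qed.

Lemma expectation_norm (X : {RV P >-> R}) : {ae P, forall x, 0 <= X x} ->
  ('E_P[X] = \int[P]_x (`|X x|)%:E)%E.
Proof.
move=> X0; rewrite expectation_def; apply: ae_eq_integral => //.
- by apply/measurable_EFinP; exact: measurable_funP.
- by apply/measurable_EFinP; apply: measurableT_comp => //; exact: measurable_funP.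
by apply: filterS X0 => x Xx _; rewrite ger0_norm.
Qed.

(** Lowering the mean by [delta] gives the law of large numbers a geometric rate; nonnegativity
    supplies the Laplace transform, and [q] depends on neither [n] nor the height [a] of the
    jump. *)
Lemma partial_sum_gt_of_big_jump (X : nat -> {RV P >-> R}) (m C delta : R) :
  iid X -> {ae P, forall x, 0 <= X 0%N x} ->
  (\int[P]_x (`|X 0%N x|)%:E = m%:E)%E ->
  (\int[P]_x (X 0%N x ^+ 2)%:E <= C%:E)%E -> 0 < delta ->
  exists q, [/\ 0 < q, q < 1 & forall n a p,
    P [set x | a < X 0%N x] = p%:E ->
    ((p * (1 - (if n == 0%N then 0 else q ^+ n)))%:E
      <= P [set x | (a + n%:R * (m - delta) < partial_sum X n.+1 x)%R])%E].
Proof.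
move=> iidX X0 Xm XC d0.
have C0 : 0 <= C.
  rewrite -lee_fin; apply: le_trans XC; apply: integral_ge0 => x _.
  by rewrite lee_fin sqr_ge0.
(* The second-order loss [l ^ 2 * (C + 1)] is then half of the first-order gain [l * delta], leaving
   the rate [q]. *)
pose l := delta / (2 * (C + 1)).
have l0 : 0 < l by rewrite divr_gt0//; lra.
have lE : l * (C + 1) = delta / 2 by rewrite /l; field; rewrite gt_eqF//; lra.
pose q := expR (- (l * delta / 2)).
exists q; split=> [||n a p Pa]; first exact: expR_gt0.
  by rewrite /q expR_lt1 oppr_lt0; apply: divr_gt0 => //; exact: mulr_gt0.
have [->|n0] := eqVneq n 0%N.
  rewrite mul0r addr0 subr0 mulr1 -Pa; have [_ /(_ 0%N 1%N) law] := iidX.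
  rewrite -!preimage_itvoy (law _ (measurable_itv _)) le_eqVlt; apply/orP; left.
  apply/eqP; congr (P _); apply/funext => x; apply/propext => /=.
  by rewrite /partial_sum big_nat1.
pose M := expR (- (l * m) + l ^+ 2 * (C + 1)).
have IM : (\int[P]_x (expR (- (l * X 0%N x)))%:E <= M%:E)%E.
  apply: le_trans (laplace_le X0 (ltW l0) Xm XC) _; rewrite lee_fin.
  apply: le_trans (expR_ge1Dx _); have := sqr_ge0 l; lra.
have := partial_sum_lower_tail n (n%:R * (m - delta)) iidX Pa IM (ltW l0).
apply: le_trans; rewrite lee_fin ler_wpM2l//.
  by rewrite -lee_fin -Pa.
rewrite lerD2l lerN2 /M -!expRM_natl -expRD ler_expR.
rewrite (_ : _ + _ = n%:R * (- l * delta + l * (l * (C + 1)))); last by ring.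
by rewrite lE ler_wpM2l//; lra.
Qed.
End MomentGenerating.

(* Chernoff's bound at the parameter [l = th' * H y / y], [theta < th' < 1], for which
   [l * s <= kappa * H s] on [s0, y] with some [kappa < 1]. *)
Lemma partial_sum_large_deviation (d : measure_display) (T : measurableType d)
    (R : realType) (P : probability T R) (X : nat -> {RV P >-> R})
    (H : R -> R) (alpha m theta K : R) :
  iid X -> {ae P, forall x, 0 <= X 0%N x} ->
  growth H alpha -> 0 < alpha -> alpha < 1 ->
  (forall t, P [set x | t < X 0%N x] = (expR (- H t))%:E) ->
  (\int[P]_x (`|X 0%N x|)%:E <= m%:E)%E ->
  0 < theta -> theta < 1 -> 0 < K ->
  exists2 y0, 0 < y0 & forall y n, y0 <= y -> n%:R <= K * y ->
    (P [set x | (n%:R * m + y < partial_sum X n x)%R]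
      <= (expR (- (theta * H y)))%:E)%E.
Proof.
move=> iidX X0 HH a0 a1 PX Xm th0 th1 K0; have [Hnd H0 _] := HH.
(* The room above [th'] allows [kappa = th' * c < 1] with [c > 1]; the room between [theta] and
   [th'] pays for the second-order term and for splitting the bound in two. *)
pose th' := (1 + theta) / 2.
have th'0 : 0 < th' by rewrite /th'; lra.
have th'1 : th' < 1 by rewrite /th'; lra.
have thth' : theta < th' by rewrite /th'; lra.
have dl0 : 0 < (th' - theta) / 2 by lra.
clearbody th'; pose c := 2 / (1 + th').
have c1 : 1 < c by rewrite ltr_pdivlMr; lra.
have k1 : th' * c < 1 by rewrite mulrA ltr_pdivrMr; lra.
clearbody c; set kappa := th' * c in k1.
have k0 : 0 < kappa by rewrite mulr_gt0//; lra.
have [s0 s00 Hs0] := growth_upper HH a1 c1.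
have [C XC] := exp_weighted_moment HH a0 a1 k0 k1 X0 PX.
pose C' := `|C| + 1.
have C'0 : 0 < C' by have := normr_ge0 C; rewrite /C'; lra.
have CC' : C <= C' by have := ler_norm C; rewrite /C'; lra.
set dl := (th' - theta) / 2 in dl0.
have e1 : 0 < (2 * s0)^-1 by rewrite invr_gt0; lra.
have e2 : 0 < dl / (K * C') by rewrite divr_gt0// mulr_gt0.
have [y1 y10 Hy1] := growth_sublinear HH a0 a1 e1.
have [y2 y20 Hy2] := growth_sublinear HH a0 a1 e2.
have th1' : 0 < 1 - theta by lra.
have [y3 y30 Hy3] := growth_exp (2 * K) HH a0 th1'.
have [y4 y40 Hy4] := growth_exp 2 HH a0 dl0.
exists (1 + s0 + y1 + y2 + y3 + y4) => [|y n yy nKy]; first by lra.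
have {}Hy1 := Hy1 y ltac:(lra).
have {}Hy2 := Hy2 y ltac:(lra).
have {}Hy3 := Hy3 y ltac:(lra).
have {}Hy4 := Hy4 y ltac:(lra).
have y_gt0 : 0 < y by lra.
pose l := th' * (H y / y).
have Hyy : 0 <= H y / y by rewrite divr_ge0// ltW.
have l0 : 0 <= l by rewrite mulr_ge0// ltW.
have lH : l <= H y / y by rewrite ler_piMl// ltW.
have ly : l * y = th' * H y by rewrite /l -mulrA divfK// gt_eqF.
have bound s : 0 <= s -> s <= y -> expR (l * s) <= 3 * expR (kappa * H s).
  move=> s_ge0 sy.
  have E1 : 1 <= expR (kappa * H s) by rewrite -expR0 ler_expR mulr_ge0// ltW.
  have [s0s|ss0] := leP s0 s.
    have : expR (l * s) <= expR (kappa * H s).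
      rewrite ler_expR /l /kappa -!mulrA (ler_pM2l th'0) mulrA mulrAC ler_pdivrMr//.
      exact: Hs0.
    by lra.
  have ls : l * s <= 1 / 2.
    apply: (@le_trans _ _ ((2 * s0)^-1 * s0)).
      apply: ler_pM => //; last exact: ltW.
      by apply: le_trans lH _; rewrite ler_pdivrMr.
    by rewrite le_eqVlt; apply/orP; left; apply/eqP; field; rewrite gt_eqF.
  have := expR_ge1Dx (- (l * s)); rewrite expRN => le1.
  have E0 := expR_gt0 (l * s).
  have : (1 - l * s) * expR (l * s) <= 1 by rewrite -ler_pdivlMr// mul1r.
  by nra.
pose M := expR (l * m + l ^+ 2 * C').
have IM : (\int[P]_x (expR (l * X 0%N x) * \1_(`]-oo, y]) (X 0%N x))%:E <= M%:E)%E.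
  apply: le_trans (mgf_truncated_le Hnd l0 bound Xm XC) _.
  rewrite lee_fin; apply: le_trans (expR_ge1Dx _).
  by rewrite addrA lerD2l ler_wpM2l ?sqr_ge0.
have Pp : (P [set x | (y < X 0%N x)%R] <= (expR (- H y))%:E)%E by rewrite PX.
apply: le_trans (partial_sum_upper_tail n (n%:R * m + y) iidX l0 Pp IM) _.
rewrite lee_fin /M -expRM_natl -expRD.
(* The union bound over the jumps: [2 * n <= 2 * K * y], which [expR ((1 - theta) * H y)]
   absorbs. *)
have T1 : n%:R * expR (- H y) <= expR (- (theta * H y)) / 2.
  have -> : expR (- (theta * H y)) = expR ((1 - theta) * H y) * expR (- H y).
    by rewrite -expRD; congr expR; ring.
  rewrite mulrAC ler_wpM2r ?expR_ge0//; lra.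
(* The mean cancels. Half of the margin [th' - theta] absorbs the quadratic term, since
   [l <= H y / y] is small; the other half makes the factor 1/2. *)
have T2 : expR (- (l * (n%:R * m + y)) + n%:R * (l * m + l ^+ 2 * C'))
    <= expR (- (theta * H y)) / 2.
  have nl : n%:R * (l ^+ 2 * C') <= dl * H y.
    apply: (@le_trans _ _ (K * y * (l ^+ 2 * C'))).
      by rewrite ler_wpM2r//; apply: mulr_ge0; [exact: sqr_ge0|exact: ltW].
    have -> : K * y * (l ^+ 2 * C') = (l * (K * C')) * (l * y) by ring.
    have lK : l * (K * C') <= dl.
      rewrite -ler_pdivlMr ?mulr_gt0//; apply: le_trans lH _.
      by rewrite ler_pdivrMr.
    apply: ler_pM => //.
    - by rewrite mulr_ge0// mulr_ge0// ltW.
    - by rewrite mulr_ge0// ltW.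
    - by rewrite ly ler_piMl// ltW.
  apply: (@le_trans _ _ (expR (- (theta * H y)) * expR (- (dl * H y)))).
    rewrite -expRD ler_expR.
    have -> : - (l * (n%:R * m + y)) + n%:R * (l * m + l ^+ 2 * C')
      = n%:R * (l ^+ 2 * C') - l * y by ring.
    by rewrite ly; move: nl; rewrite /dl; lra.
  rewrite ler_wpM2l ?expR_ge0// expRN lef_pV2 ?posrE ?expR_gt0//; lra.
lra.
Qed.

(** * The minimum of independent variables *)

Section Minimum.
Context (d : measure_display) (T : measurableType d) (R : realType)
  (P : probability T R) (Y : nat -> {RV P >-> R}).

(** Naming an index that attains the minimum replaces the quantifier over reals by countable
    operations, whence measurability. *)
Lemma min_gtE (t : R) : min_gt Y t = \bigcup_(k in [set k | (0 < k)%N])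
  ([set x | t < Y k x] `&`
   \bigcap_(n in [set n | (0 < n)%N]) [set x | Y k x <= Y n x]).
Proof.
apply/seteqP; split => x.
  move=> [_ [[[k k0 <-] lb] tm]]; exists k => //; split=> // n n0 /=.
  by apply: lb; exists n.
move=> [k k0 [tk kn]]; exists (Y k x); split=> //; split; first by exists k.
by move=> _ [n n0 <-]; exact: kn.
Qed.

Lemma measurable_min_gt (t : R) : measurable (min_gt Y t).
Proof.
rewrite min_gtE; apply: bigcup_measurable => k _; apply: measurableI.
  exact: measurable_ray.
apply: bigcap_measurableType => n _; rewrite -[X in measurable X]setTI.
by apply: measurable_fun_le => //; exact: measurable_funP.
Qed.

Definition all_gt (t : R) (N : nat) : set T :=
  \bigcap_(i in [set` iota 1 N]) (Y i @^-1` `]t, +oo[).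

Lemma measurable_all_gt (t : R) (N : nat) : measurable (all_gt t N).
Proof.
apply: bigcap_measurableType => n _; rewrite -[X in measurable X]setTI.
by apply: measurable_funP.
Qed.

Hypothesis indepY : mutually_independent [set n : nat | (0 < n)%N] Y.

Lemma all_gtE (t : R) (N : nat) :
  P (all_gt t N) = (\prod_(1 <= i < N.+1) P [set x | (t < Y i x)%R])%E.
Proof.
rewrite /all_gt (indepY (B := fun=> `]t, +oo[%classic)) ?iota_uniq//; last first.
  by move=> i; rewrite mem_iota => /andP[].
rewrite /index_iota subSS subn0.
by apply: eq_bigr => i _; rewrite preimage_itvoy.
Qed.

Lemma min_gt_le_prod (t : R) (N : nat) :
  (P (min_gt Y t) <= \prod_(1 <= i < N.+1) P [set x | (t < Y i x)%R])%E.
Proof.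
rewrite -all_gtE; apply: le_measure; rewrite ?inE.
- exact: measurable_min_gt.
- exact: measurable_all_gt.
move=> x [m [[_ lb] tm]] i; rewrite /= mem_iota in_itv /= andbT => /andP[i0 _].
by apply: lt_le_trans tm _; apply: lb; exists i.
Qed.

(* By Borel-Cantelli, almost surely only finitely many [Y n] lie below any given
   level, so that the minimum is attained. *)
Lemma min_gt_ge (t c : R) :
  (forall M : nat, (\sum_(n <oo) P [set x | (Y n x <= M%:R)%R] < +oo)%E) ->
  (forall N, (c%:E <= \prod_(1 <= i < N.+1) P [set x | (t < Y i x)%R])%E) ->
  (c%:E <= P (min_gt Y t))%E.
Proof.
move=> BC cprod.
have mF M n : measurable [set x | Y n x <= M%:R].
  rewrite -[X in measurable X]setTI.
  by apply: measurable_fun_le => //; exact: measurable_funP.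
pose L (M : nat) := lim_sup_set (fun n => [set x | Y n x <= M%:R]).
have L0 M : P (L M) = 0%E by apply: lim_sup_set_cvg0; [exact: mF|exact: BC].
have mL M : measurable (L M).
  by apply: bigcap_measurableType => n _; apply: bigcup_measurable.
pose E := \bigcap_N all_gt t N.
have mE : measurable E.
  by apply: bigcap_measurableType => N _; exact: measurable_all_gt.
(* Continuity from above turns the bound on finite products into one for all indices at once. *)
have cE : (c%:E <= P E)%E.
  have cv : P (all_gt t N) @[N --> \oo] --> P E.
    apply: nonincreasing_cvg_mu => //.
    - by rewrite -ge0_fin_numE ?fin_num_measure//; exact: measurable_all_gt.
    - by move=> N; exact: measurable_all_gt.
    move=> N N' NN'; apply/subsetPset => x xN' i /=; rewrite mem_iota => iN.
    by apply: xN'; rewrite /= mem_iota; lia.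
  rewrite -(cvg_lim _ cv)//; apply: lime_ge; first by apply/cvg_ex; exists (P E).
  by apply: nearW => N; rewrite all_gtE.
apply: le_trans cE _.
have EL : E `<=` min_gt Y t `|` \bigcup_M L M.
  move=> x Ex; have [|nL] := pselect ((\bigcup_M L M) x); [by right|left].
  (* Integer levels keep the exceptional set a countable union of null sets. From some [n0] on,
     [Y n x] exceeds [Y 1 x], so a minimum over the first indices is global. *)
  pose M := (Num.trunc `|Y 1%N x|).+1.
  have YM : Y 1%N x <= M%:R by apply: le_trans (ler_norm _) (ltW (truncnS_gt _)).
  have [n0 Hn0] : exists n0, forall n, (n0 <= n)%N -> M%:R < Y n x.
    apply: contrapT => nex; apply: nL; exists M => // n0 _.
    apply: contrapT => nall; apply: nex; exists n0 => n n0n.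
    by rewrite ltNge; apply/negP => YnM; apply: nall; exists n.
  rewrite min_gtE.
  have [i0 _ i0min] := @Order.TotalTheory.arg_minP _ R 'I_n0.+1 ord0 xpredT
    (fun i => Y i.+1 x) isT.
  exists i0.+1 => //; split.
    have i0in : i0.+1 \in iota 1 i0.+1 by rewrite mem_iota; lia.
    have := Ex i0.+1 I i0.+1 i0in.
    by rewrite /= in_itv /= andbT.
  move=> [//|n] _ /=; have [nn0|n0n] := ltnP n n0.+1.
    exact: (i0min (Ordinal nn0)).
  apply: le_trans (i0min ord0 isT) _; apply: le_trans YM _.
  by apply: ltW; apply: Hn0; lia.
apply: (@le_trans _ _ (P (min_gt Y t `|` \bigcup_M L M))).
  apply: le_measure => //; rewrite inE//; apply: measurableU.
    exact: measurable_min_gt.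
  exact: bigcup_measurable.
have mmin := measurable_min_gt t.
have mU : measurable (\bigcup_M L M) by exact: bigcup_measurable.
apply: le_trans (measureU2 _ mmin mU) _.
rewrite [X in (_ + X)%E](_ : _ = 0)%E ?adde0//.
apply/eqP; rewrite eq_le measure_ge0 andbT.
apply: le_trans (measure_sigma_subadditive P mL mU (@subset_refl _ _)) _.
by rewrite eseries0// => n _ _; exact: L0.
Qed.
End Minimum.

Lemma lee_prode (R : realType) (I : Type) (s : seq I) (f g : I -> \bar R) :
  (forall i, 0 <= f i)%E -> (forall i, f i <= g i)%E ->
  (\prod_(i <- s) f i <= \prod_(i <- s) g i)%E.
Proof.
move=> f0 fg; elim: s => [|i s IH]; first by rewrite !big_nil.
by rewrite !big_cons lee_pmul// prode_ge0.
Qed.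

(** * Regular variation and moments from the tail hypothesis *)

Lemma neg_log_tail_growth (d : measure_display) (T : measurableType d)
    (R : realType) (P : probability T R) (X : {RV P >-> R}) (alpha : R)
    (l : R -> R) :
  {ae P, forall x, 0 <= X x} -> slowly_varying l ->
  (forall t, 0 < t -> P [set x | t < X x] = (expR (- (t `^ alpha * l t)))%:E) ->
  let H := neg_log_tail P X in
  [/\ growth H alpha, forall t, P [set x | t < X x] = (expR (- H t))%:E,
      forall t, 0 < t -> H t = t `^ alpha * l t & forall t, t < 0 -> H t = 0].
Proof.
move=> X0 [_ lslow] PXt H.
have mray t : measurable [set x | t < X x] by exact: measurable_ray.
have Pray (s t : R) : s <= t -> (P [set x | (t < X x)%R] <= P [set x | (s < X x)%R])%E.
  by move=> st; apply: le_measure; rewrite ?inE// => x /=; exact: le_lt_trans.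
pose p t := fine (P [set x | t < X x]).
have pE t : P [set x | t < X x] = (p t)%:E by rewrite fineK// fin_num_measure.
have p_gt0 t : 0 < p t.
  (* The tail formula covers positive arguments only; the tail at [t] is at least that at
     [max t 1]. *)
  rewrite -lte_fin -pE; apply: lt_le_trans (Pray t (Num.max t 1) _).
    by rewrite PXt ?lte_fin ?expR_gt0// lt_max ltr01 orbT.
  by rewrite le_max lexx.
have pH t : p t = expR (- H t).
  by rewrite /H /neg_log_tail opprK lnK// posrE; exact: p_gt0.
have Hpos t : 0 < t -> H t = t `^ alpha * l t.
  by move=> t0; rewrite /H /neg_log_tail PXt//= expRK opprK.
have H0 t : 0 <= H t.
  by rewrite oppr_ge0 ln_le0// -lee_fin -pE probability_le1.
split=> //.
- split=> // [s t st|c c0].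
    have HpE r : H r = - ln (p r) by [].
    by rewrite !HpE lerN2 ler_ln ?posrE// -lee_fin -!pE; exact: Pray.
  have -> : c `^ alpha = c `^ alpha * 1 by rewrite mulr1.
  apply: cvg_trans (cvgM (cvg_cst (c `^ alpha)) (lslow c c0)).
  apply: near_eq_cvg; near=> t.
  have t0 : 0 < t by near: t; apply: nbhs_pinfty_gt; exact: num_real.
  rewrite !Hpos ?mulr_gt0// powRM ?ltW//.
  have ta : t `^ alpha != 0 by rewrite gt_eqF// powR_gt0.
  rewrite /= invfM; move: (t `^ alpha) (l t)^-1 ta => u v u0.
  by field.
- by move=> t; rewrite pE pH.
(* A negative level is exceeded almost surely; this is what makes a jump cost nothing once [n * m]
   exceeds [t]. *)
move=> t t0; suff -> : H t = - ln 1 by rewrite ln1 oppr0.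
rewrite /H /neg_log_tail; congr (- ln _).
suff -> : P [set x | t < X x] = 1%E by [].
have mA : measurable (~` [set x | t < X x]) by exact: measurableC.
have : P (~` [set x | t < X x]) = 0%E.
  apply: measure_negligible => //; apply: negligibleS X0 => x /= tX Xx.
  by apply: tX; exact: lt_le_trans Xx.
by rewrite probability_setC// => /eqP; rewrite pE -EFinB eqe subr_eq0 => /eqP <-.
Unshelve. all: by end_near. Qed.

Lemma mean_and_second_moment (d : measure_display) (T : measurableType d)
    (R : realType) (P : probability T R) (X : {RV P >-> R}) (H : R -> R)
    (alpha : R) :
  {ae P, forall x, 0 <= X x} -> growth H alpha -> 0 < alpha -> alpha < 1 ->
  (forall t, P [set x | t < X x] = (expR (- H t))%:E) ->
  exists C : R, [/\ (\int[P]_x (X x ^+ 2)%:E <= C%:E)%E, ('E_P[X] < +oo)%E,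
    (\int[P]_x (`|X x|)%:E = (fine 'E_P[X])%:E)%E & 0 < fine 'E_P[X]].
Proof.
move=> X0 HH a0 a1 PX; have [Hnd H0 _] := HH.
have h1 : 1 / 2 < 1 :> R by lra.
have h0 : 0 < 1 / 2 :> R by lra.
have [C XC] := exp_weighted_moment HH a0 a1 h0 h1 X0 PX.
have mX : measurable_fun setT X by exact: measurable_funP.
have mn : measurable_fun setT (fun x => `|X x|) by exact: measurableT_comp.
have m2 : measurable_fun setT (fun x => X x ^+ 2) by exact: measurable_funX.
have mH : measurable_fun setT H by exact: nondecreasing_measurable.
have mf : measurable_fun setT (fun x => 3 * X x ^+ 2 * expR (1 / 2 * H (X x))).
  apply: measurable_funM; first exact: measurable_funM.
  apply: measurableT_comp => //; apply: measurable_funM => //.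
  exact: measurableT_comp.
have XC2 : (\int[P]_x (X x ^+ 2)%:E <= C%:E)%E.
  apply: le_trans XC; apply: ge0_le_integral => //.
  - by move=> x _; rewrite lee_fin sqr_ge0.
  - exact/measurable_EFinP.
  - exact/measurable_EFinP.
  - move=> x _; rewrite lee_fin.
    have : 1 <= expR (1 / 2 * H (X x)) by rewrite -expR0 ler_expR mulr_ge0// ltW.
    have := sqr_ge0 (X x); nra.
have le1 := integral_affine_le m2 m2 (fun x => sqr_ge0 _) (fun x => sqr_ge0 _)
  ler01 (lexx 0) XC2 XC2.
have Efin : ('E_P[X] < +oo)%E.
  rewrite expectation_norm//; apply: le_lt_trans (ltry (1 + 1 * C + 0 * C)).
  apply: le_trans le1; apply: ge0_le_integral => //.
  - exact/measurable_EFinP.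
  - apply/measurable_EFinP; apply: measurable_funD; last exact: measurable_funM.
    by apply: measurable_funD => //; exact: measurable_funM.
  - move=> x _; rewrite lee_fin mul0r addr0 mul1r -[X x ^+ 2]real_normK ?num_real//.
    by have := sqr_ge0 (`|X x| - 1); nra.
have E0 : (0 <= 'E_P[X])%E by rewrite expectation_norm//; exact: integral_ge0.
exists C; split=> //.
  by rewrite fineK ?ge0_fin_numE// expectation_norm.
rewrite -lte_fin fineK ?ge0_fin_numE// expectation_norm//.
apply: (@lt_le_trans _ _ (P [set x | 1 < X x])).
  by rewrite PX lte_fin expR_gt0.
have m1 : measurable [set x | 1 < X x] by exact: measurable_ray.
rewrite -[X in (P X <= _)%E]setIT -integral_indic//; apply: ge0_le_integral => //.
- by apply/measurable_EFinP; exact: measurable_indic.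
- exact/measurable_EFinP.
- move=> x _; rewrite lee_fin indicE.
  have [|_] := boolP (x \in _); last by rewrite normr_ge0.
  by rewrite inE /= => X1; have := ler_norm (X x); lra.
Qed.

(** * Two-sided bounds for the tail of the minimum *)

Section ProductBounds.
Context (d : measure_display) (T : measurableType d) (R : realType)
  (P : probability T R) (X Y : nat -> {RV P >-> R}) (H : R -> R)
  (alpha mu C : R).
Hypotheses (iidX : iid X) (X0 : {ae P, forall x, 0 <= X 0%N x})
  (indepY : mutually_independent [set n : nat | (0 < n)%N] Y)
  (lawY : forall n, (0 < n)%N -> same_law P (Y n) (partial_sum X n))
  (HH : growth H alpha) (alpha_gt0 : 0 < alpha) (alpha_lt1 : alpha < 1)
  (PX : forall t, P [set x | t < X 0%N x] = (expR (- H t))%:E)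
  (Hneg : forall t, t < 0 -> H t = 0)
  (Xmu : (\int[P]_x (`|X 0%N x|)%:E = mu%:E)%E) (mu_gt0 : 0 < mu)
  (XC : (\int[P]_x (X 0%N x ^+ 2)%:E <= C%:E)%E).

Lemma tail_law (n : nat) (t : R) : (0 < n)%N ->
  P [set x | t < Y n x] = P [set x | t < partial_sum X n x].
Proof. by move=> n0; rewrite -!preimage_itvoy lawY. Qed.

Lemma min_gt_upper (theta e : R) : 0 < theta -> theta < 1 -> 0 < e -> e < 1 ->
  exists2 t0, 0 < t0 & forall t, t0 <= t ->
    (P (min_gt Y t) <= (expR (- (theta *
      \sum_(n < Num.trunc ((1 - e) * t / mu)) H (t - n.+1%:R * mu))))%:E)%E.
Proof.
move=> th0 th1 e0 e1.
(* If [n * mu <= (1 - e) * t], then [y = t - n * mu >= e * t], so [n <= t / mu <= y / (e * mu)]. *)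
have K0 : 0 < (e * mu)^-1 by rewrite invr_gt0 mulr_gt0.
have Xmu' : (\int[P]_x (`|X 0%N x|)%:E <= mu%:E)%E by rewrite Xmu.
have [y0 y00 LD] := partial_sum_large_deviation iidX X0 HH alpha_gt0 alpha_lt1
  PX Xmu' th0 th1 K0.
exists (y0 / e) => [|t tt]; first by rewrite divr_gt0.
have yet : y0 <= e * t by rewrite mulrC -ler_pdivrMr.
have t0 : 0 < t by apply: lt_le_trans tt; rewrite divr_gt0.
set N := Num.trunc _.
apply: le_trans (min_gt_le_prod indepY t N) _.
rewrite mulr_sumr -sumrN expR_sum -prodEFin big_add1 /= big_mkord.
apply: lee_prode => [n|n]; first exact: measure_ge0.
rewrite tail_law//.
have et0 : 0 <= (1 - e) * t / mu.
  by rewrite divr_ge0 ?(ltW mu_gt0)// mulr_ge0 ?(ltW t0)//; lra.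
have nN : n.+1%:R * mu <= (1 - e) * t.
  rewrite -ler_pdivlMr//; have /andP[Nt _] := truncn_itv et0.
  by apply: le_trans Nt; rewrite ler_nat.
have := LD (t - n.+1%:R * mu) n.+1.
rewrite (addrC (n.+1%:R * mu)) subrK; apply; first by lra.
rewrite mulrC ler_pdivlMr ?mulr_gt0// mulrCA.
apply: (@le_trans _ _ (e * t)); last by lra.
by rewrite ler_pM2l//; have := mulr_gt0 e0 t0; lra.
Qed.

(** [K] collects the failures of the law of large numbers over all [n]; it depends on [delta] but
    not on [t], so it vanishes in the limit. The same geometric rate feeds Borel-Cantelli. *)
Lemma min_gt_lower (delta : R) : 0 < delta -> delta < mu ->
  exists K : R, forall t, 0 < t ->
    ((expR (- (\sum_(n < (Num.trunc (t / (mu - delta))).+1)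
        H (t - n%:R * (mu - delta)) + K)))%:E <= P (min_gt Y t))%E.
Proof.
move=> d0 dmu; have [Hnd H0 _] := HH.
have [q [q0 q1 qP]] := partial_sum_gt_of_big_jump iidX X0 Xmu XC d0.
set m := mu - delta in qP *; have m0 : 0 < m by rewrite subr_gt0.
exists ((1 - q)^-1 ^+ 2) => t t0.
have jump n s : ((expR (- H (s - n%:R * m))
    * (1 - (if n == 0%N then 0 else q ^+ n)))%:E
    <= P [set x | (s < Y n.+1 x)%R])%E.
  have := qP n (s - n%:R * m) (expR (- H (s - n%:R * m))) (PX _).
  by rewrite subrK tail_law.
apply: (min_gt_ge indepY) => [M|N].
  have mY n : measurable [set x | M%:R < Y n x] by exact: measurable_ray.
  have YC n : P [set x | Y n x <= M%:R] = (1 - P [set x | (M%:R < Y n x)%R])%E.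
    rewrite -probability_setC//; congr (P _); apply/seteqP; split => x /=.
      by move=> YM; apply/negP; rewrite -leNgt.
    by move=> /negP; rewrite -leNgt.
  have mYC n : measurable [set x | Y n x <= M%:R].
    rewrite -[X in measurable X]setTI.
    by apply: measurable_fun_le => //; exact: measurable_funP.
  under eq_eseriesr => n _ do rewrite -[P _]fineK ?fin_num_measure//.
  (* The estimate for index [n.+1] is [q ^ n], hence the factor [q^-1]. Beyond [M / m] the argument
     of [H] is negative, so only the failure probability remains. *)
  apply: (@nneseries_eventually_le _ _ (fun n => q^-1 * q ^+ n)
    (q^-1 * (1 - q)^-1) (Num.trunc (M%:R / m)).+3).
  - by move=> n; exact: fine_ge0.
  - by move=> n; rewrite mulr_ge0 ?exprn_ge0 ?invr_ge0// ltW.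
  - case=> // n nM; rewrite YC exprS mulKf ?gt_eqF//.
    have := jump n M%:R; rewrite Hneg; last first.
      rewrite subr_lt0 -ltr_pdivrMr//; apply: lt_le_trans (truncnS_gt _) _.
      by rewrite ler_nat; exact: ltnW.
    have -> : (n == 0%N) = false by case: (n) nM.
    rewrite oppr0 expR0 mul1r -[P _]fineK ?fin_num_measure// lee_fin /=.
    by lra.
  - move=> n; rewrite -mulr_sumr ler_wpM2l ?invr_ge0 ?(ltW q0)//.
    by rewrite geometric_sum_le// ltW.
rewrite big_add1 /=.
apply: (@le_trans _ _ (\prod_(0 <= n < N) (expR (- H (t - n%:R * m))
    * (1 - (if n == 0%N then 0 else q ^+ n)))%:E)%E); last first.
  apply: lee_prode => n; last exact: jump.
  rewrite lee_fin mulr_ge0 ?expR_ge0//; case: eqP => _; first by rewrite subr0.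
  by rewrite subr_ge0 exprn_ile1// ltW.
rewrite prodEFin lee_fin big_split/= opprD expRD ler_pM ?expR_ge0//; last first.
  exact: geometric_product_ge.
rewrite -expR_sum ler_expR sumrN lerN2 -(big_mkord xpredT (fun n => H (t - n%:R * m))).
set M := (Num.trunc _).+1.
(* Indices from [M] on contribute [H = 0], so the bound is uniform in [N]. *)
have [NM|MN] := leqP N M.
  by rewrite [leRHS](big_cat_nat _ NM)//= lerDl sumr_ge0.
rewrite (big_cat_nat _ (ltnW MN))//= -[leRHS]addr0 lerD2l big_nat big1// => n.
move=> /andP[Mn _]; apply: Hneg; rewrite subr_lt0 -ltr_pdivrMr//.
by apply: lt_le_trans (truncnS_gt _) _; rewrite ler_nat.
Qed.
End ProductBounds.

Unset Implicit Arguments.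

(* xi 0 is the generic variable xi; hatS 0 is unused. *)
Theorem theorem3p6 (d : measure_display) (T : measurableType d)
    (R : realType) (P : probability T R)
    (xi hatS : nat -> {RV P >-> R}) (alpha : R) (l : R -> R)
    (xi_iid : iid xi)
    (xi_ge0 : forall n, {ae P, forall x, 0 <= xi n x})
    (hatS_indep : mutually_independent [set n : nat | (0 < n)%N] hatS)
    (hatS_law : forall n, (0 < n)%N -> same_law P (hatS n) (partial_sum xi n))
    (alpha_gt0 : 0 < alpha) (alpha_lt1 : alpha < 1)
    (l_slow : slowly_varying l)
    (xi_tail : forall t, 0 < t ->
       P [set x | t < xi 0%N x] = (expR (- (t `^ alpha * l t)))%:E)
    (H_incr : let H := neg_log_tail P (xi 0%N) in
       forall Delta : R -> R, Delta t / t @[t --> +oo] --> (0 : R) ->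
       exists e1 e2 : R -> R,
         [/\ e1 t @[t --> +oo] --> (0 : R),
             e2 t @[t --> +oo] --> (0 : R) &
             \forall t \near +oo,
               H (t + Delta t) - H t =
               alpha * Delta t * t^-1 * H t * (1 + e1 t) + e2 t]) :
  ('E_P[xi 0%N] < +oo)%E /\
  (let mu := fine 'E_P[xi 0%N] in
   (- ln (fine (P (min_gt hatS t))) / (t `^ (alpha + 1) * l t))
     @[t --> +oo] --> (mu * (alpha + 1))^-1).
Proof.
have X0 := xi_ge0 0%N.
have := neg_log_tail_growth X0 l_slow xi_tail.
set H := neg_log_tail P (xi 0%N); move=> [HH PX Hpos Hneg].
have [Hnd H0 _] := HH.
have [C [XC Efin Xmu mu_gt0]] := mean_and_second_moment X0 HH alpha_gt0 alpha_lt1 PX.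
split=> //=; set mu := fine _ in Xmu mu_gt0 *.
have a1 : 0 < alpha + 1 by lra.
have mua : 0 < mu * (alpha + 1) by rewrite mulr_gt0.
pose c := (mu * (alpha + 1))^-1; have c0 : 0 < c by rewrite invr_gt0.
have [tH tH0 Htpos] := growth_gt0 HH.
have DE t : 0 < t -> t `^ (alpha + 1) * l t = t * H t.
  move=> t0; rewrite Hpos// powRD; last by apply/implyP => _; rewrite gt_eqF.
  by rewrite powRr1 ?(ltW t0)//; ring.
apply/cvgrPdist_le => /= eps eps0.
(* Chosen for [(1 - e) * ((1 - e) * c - e) >= c - e * (2 * c + 1) >= c - eps]. *)
pose e := Num.min (1 / 2) (eps / (2 * c + 1)).
have e0 : 0 < e by rewrite lt_min !divr_gt0//; lra.
have e12 : e <= 1 / 2 by rewrite ge_min lexx.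
have ec : e * (2 * c + 1) <= eps.
  by rewrite -ler_pdivlMr; [rewrite ge_min lexx orbT|lra].
have th0 : 0 < 1 - e by lra.
have th1 : 1 - e < 1 by lra.
have e1 : e < 1 by lra.
have [t1 t10 Ht1] := min_gt_upper xi_iid X0 hatS_indep hatS_law HH alpha_gt0 alpha_lt1
  PX Xmu mu_gt0 th0 th1 e0 e1.
have [t2 t20 Ht2] := growth_sum_lower HH alpha_gt0 mu_gt0 e0 e1.
(* Keeps the limit constant for the mean [mu - dl] within [eps / 4] of [c]. Another [eps / 4] goes
   to the Riemann sum and [eps / 2] to [K]. *)
pose dl := Num.min (mu / 2) (eps * mu ^+ 2 / 8).
have dl0 : 0 < dl by rewrite lt_min !divr_gt0// mulr_gt0// exprn_gt0.
have dlmu : dl <= mu / 2 by rewrite ge_min lexx.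
have dle : dl <= eps * mu ^+ 2 / 8 by rewrite ge_min lexx orbT.
have dl_lt : dl < mu by lra.
have m0 : 0 < mu - dl by lra.
have [K HK] := min_gt_lower xi_iid X0 hatS_indep hatS_law HH PX Hneg Xmu XC dl0 dl_lt.
have e4 : 0 < eps / 4 by rewrite divr_gt0.
have [t3 t30 Ht3] := growth_sum_upper HH alpha_gt0 m0 e4.
have HtH := Htpos tH (lexx tH).
near=> t.
have t_gt0 : 0 < t by near: t; apply: nbhs_pinfty_gt; exact: num_real.
have tt1 : t1 <= t by near: t; apply: nbhs_pinfty_ge; exact: num_real.
have tt2 : t2 <= t by near: t; apply: nbhs_pinfty_ge; exact: num_real.
have tt3 : t3 <= t by near: t; apply: nbhs_pinfty_ge; exact: num_real.
have ttH : tH <= t by near: t; apply: nbhs_pinfty_ge; exact: num_real.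
have ttK : 2 * K / (eps * H tH) <= t by near: t; apply: nbhs_pinfty_ge; exact: num_real.
have Ht : 0 < H t by exact: Htpos.
rewrite DE//; set D := t * H t; have D0 : 0 < D by rewrite mulr_gt0.
pose p := fine (P (min_gt hatS t)).
have pE : P (min_gt hatS t) = p%:E.
  by rewrite fineK// fin_num_measure//; exact: measurable_min_gt.
have := HK t t_gt0; have := Ht1 t tt1; rewrite pE !lee_fin => pU pL.
have p0 : 0 < p by apply: lt_le_trans pL; exact: expR_gt0.
rewrite -/p -/c.
have lnU : ln p <= - ((1 - e) * (((1 - e) * c - e) * D)).
  rewrite -[leRHS]expRK ler_ln ?posrE ?expR_gt0//; apply: le_trans pU _.
  by rewrite ler_expR lerN2 ler_wpM2l ?(ltW th0)//; exact: Ht2.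
have lnL : - ((((mu - dl) * (alpha + 1))^-1 + eps / 4) * D + K) <= ln p.
  rewrite -[leLHS]expRK ler_ln ?posrE ?expR_gt0//; apply: le_trans pL.
  by rewrite ler_expR lerN2 lerD2r; exact: Ht3.
(* By monotonicity [D >= t * H tH], so a threshold linear in [K] suffices. *)
have KD : K <= eps / 2 * D.
  have -> : eps / 2 * D = eps * H t * t / 2 by rewrite /D; ring.
  rewrite ler_pdivlMr// mulrC; rewrite ler_pdivrMr ?mulr_gt0// in ttK.
  apply: le_trans ttK _; rewrite mulrC ler_wpM2r ?(ltW t_gt0)//.
  by rewrite ler_pM2l//; exact: Hnd.
have cm : ((mu - dl) * (alpha + 1))^-1 <= c + eps / 4.
  rewrite -div1r ler_pdivrMr ?mulr_gt0//.
  have cE : c * (mu * (alpha + 1)) = 1 by rewrite mulVf// gt_eqF.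
  have cE' : dl * (c * (alpha + 1)) = dl / mu by rewrite /c; field; rewrite !gt_eqF.
  have le1 : dl / mu <= eps * mu / 8 by rewrite ler_pdivrMr//; lra.
  have le2 : eps * mu / 8 <= eps / 4 * ((mu - dl) * (alpha + 1)).
    rewrite (_ : eps * mu / 8 = eps / 4 * (mu / 2)); last by field.
    rewrite ler_pM2l//; apply: (@le_trans _ _ (mu - dl)); first by lra.
    by rewrite ler_peMr ?(ltW m0)//; lra.
  rewrite [leRHS](_ : _ = c * (mu * (alpha + 1)) - dl * (c * (alpha + 1))
    + eps / 4 * ((mu - dl) * (alpha + 1))); last by ring.
  by rewrite cE cE'; lra.
rewrite ler_distlC; apply/andP; split.
  rewrite ler_pdivlMr//.
  have : ((1 - e) * ((1 - e) * c - e) - (c - eps)) * D >= 0.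
    by rewrite mulr_ge0 ?(ltW D0)//; have := mulr_gt0 e0 c0; nra.
  by lra.
rewrite ler_pdivrMr//.
have : ((mu - dl) * (alpha + 1))^-1 * D <= (c + eps / 4) * D by rewrite ler_wpM2r// ltW.
by lra.
Unshelve. all: by end_near. Qed.
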